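(* Let $p$ be a predicate defined by the inductive pattern-based clauses $\{\forall\vec x_i.(\nabla\vec z_i.\,p\,\vec t_i)\stackrel{\mu}{=}B_i\,p\,\vec x_i\}_{i\in 1..n}$, interpreted in the logic $\mathcal{G}$ described below by the single translated clause $\forall\vec y.\ p\,\vec y\stackrel{\mu}{=}\bigvee_{i\in 1..n}\exists\vec x_i.\big(((\lambda\vec z_i.\,p'\,\vec t_i)\unrhd p'\,\vec y)\land B_i\,p\,\vec x_i\big)$, where $p'$ is a new constant with the same argument types as $p$ and the variables $\vec y$ do not occur in any $\vec t_i$. Then the following rule $\mathcal{IL}^p$ is admissible in $\mathcal{G}$ with this translated definition: from the premises $\{\vec x_i : B_i\,S\,\vec x_i\vdash\nabla\vec z_i.\,S\,\vec t_i\}_{i\in 1..n}$ and $\Sigma:\Gamma,S\,\vec s\vdash C$, infer $\Sigma:\Gamma,p\,\vec s\vdash C$, where $S$ is a term of the same type as $p$ containing no nominal constants.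
   Context: A pattern-based definition is a finite collection of clauses $\forall\vec x.(\nabla\vec z.\,p\,\vec t)\stackrel{\mu}{=}B\,p\,\vec x$ (all clauses of a given predicate annotated uniformly) where $\vec t$ are terms containing no nominal constants, $p\,\vec t$ has type $o$, and $B$ contains no occurrences of $p$, $\vec x$ or nominal constants with $B\,p\,\vec t$ of type $o$; several clauses may define the same $p$; stratified: $\mathrm{lvl}(B\,(\lambda\vec x.\top)\,\vec x)<\mathrm{lvl}(p)$ for every clause (levels as below). THE LOGIC $\mathcal{G}$. Terms are simply typed (Church) $\lambda$-terms over constants and variables, identified up to $\alpha\beta\eta$-conversion. There is a type $o$ of formulas; $o$ does not occur in argument types of non-logical constants nor in types of eigenvariables. Logical constants: $\top,\bot,\land,\lor,\supset$, and for each type $\tau$ not containing $o$, $\forall_\tau,\exists_\tau,\nabla_\tau$ of type $(\tau\to o)\to o$. Constants are partitioned into nominal constants $\mathcal{C}$ (infinitely many at each type at which $\nabla$ is allowed) and ordinary constants $\mathcal{K}$. $\mathrm{supp}(t)$ is the set of nominal constants in $t$. A permutation $\pi$ is a type-preserving bijection of $\mathcal{C}$ moving finitely many elements, acting on terms by renaming nominal constants; $B\approx B'$ iff $B$ $\lambda$-converts to $\pi.B'$ for some $\pi$. Substitutions: type-preserving maps from variables to terms, identity almost everywhere; $\mathrm{supp}(\theta)$ = nominal constants in the range. $B[\theta]$ is ordinary capture-avoiding application; $B\langle\theta\rangle=(\pi.B)[\theta]$ for a permutation $\pi$ sending $\mathrm{supp}(B)$ outside $\mathrm{supp}(\theta)$;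 $\Gamma\langle\theta\rangle=\{B\langle\theta\rangle\mid B\in\Gamma\}$. $\Sigma\theta$ is $\Sigma$ with the domain variables of $\theta$ removed and all free variables of the range terms added. Nominal abstraction: for $s:\tau_1\to\cdots\to\tau_n\to\tau$ and $t:\tau$, $s\unrhd t$ is a formula; ''$s\unrhd t$ holds'' iff $s$ $\lambda$-converts to $\lambda c_1\dots\lambda c_n.t$ (the $c_i$ distinct nominal constants abstracted out of $t$ by replacing them with fresh bound variables). $\theta$ is a solution to $s\unrhd t$ iff $(s\unrhd t)\langle\theta\rangle$ holds. Definitions of $\mathcal{G}$: a fixed finite set of clauses $\forall\vec x.\,p\,\vec x \triangleq B\,p\,\vec x$ (or $\stackrel{\mu}{=}$, inductive, or $\stackrel{\nu}{=}$, co-inductive), at most one per predicate constant $p$, where $B$ contains no $p$, no $\vec x$ and no nominal constants, and stratified: there are levels $\mathrm{lvl}(p)\in\mathbb{N}$, extended to $\lambda$-normal formulas by $\mathrm{lvl}(p\,\vec t)=\mathrm{lvl}(p)$, $\mathrm{lvl}(\top)=\mathrm{lvl}(\bot)=\mathrm{lvl}(s\unrhd t)=0$, $\mathrm{lvl}(B\land C)=\mathrm{lvl}(B\lor C)=\max$, $\mathrm{lvl}(B\supset C)=\max(\mathrm{lvl}(B)+1,\mathrm{lvl}(C))$, quantifiers transparent, with $\mathrm{lvl}(B\,(\lambda\vec x.\top)\,\vec x)<\mathrm{lvl}(p)$ for every clause. Sequents $\Sigma:\Gamma\vdash C$: $\Sigma$ a set of eigenvariables containing the free variables of $\Gamma,C$;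 $\Gamma$ a multiset. Rules: id: $\Sigma:\Gamma,B\vdash B'$ if $B\approx B'$. cut: from $\Sigma:\Gamma\vdash B$ and $\Sigma:B,\Delta\vdash C$ infer $\Sigma:\Gamma,\Delta\vdash C$. $c\mathcal{L}$: from $\Sigma:\Gamma,B,B\vdash C$ infer $\Sigma:\Gamma,B\vdash C$. $\bot\mathcal{L}$: $\Sigma:\Gamma,\bot\vdash C$. $\top\mathcal{R}$: $\Sigma:\Gamma\vdash\top$. $\lor\mathcal{L}$: from $\Sigma:\Gamma,B\vdash C$ and $\Sigma:\Gamma,D\vdash C$ infer $\Sigma:\Gamma,B\lor D\vdash C$. $\lor\mathcal{R}$: from $\Sigma:\Gamma\vdash B_i$ infer $\Sigma:\Gamma\vdash B_1\lor B_2$. $\land\mathcal{L}$: from $\Sigma:\Gamma,B_i\vdash C$ infer $\Sigma:\Gamma,B_1\land B_2\vdash C$. $\land\mathcal{R}$: from $\Sigma:\Gamma\vdash B$ and $\Sigma:\Gamma\vdash C$ infer $\Sigma:\Gamma\vdash B\land C$. $\supset\mathcal{L}$: from $\Sigma:\Gamma\vdash B$ and $\Sigma:\Gamma,D\vdash C$ infer $\Sigma:\Gamma,B\supset D\vdash C$. $\supset\mathcal{R}$: from $\Sigma:\Gamma,B\vdash C$ infer $\Sigma:\Gamma\vdash B\supset C$. $\forall\mathcal{L}$ / $\exists\mathcal{R}$: from $\Sigma:\Gamma,B[t/x]\vdash C$ (resp. $\Sigma:\Gamma\vdash B[t/x]$) infer $\Sigma:\Gamma,\forall_\tau x.B\vdash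 C$ (resp. $\Sigma:\Gamma\vdash\exists_\tau x.B$), where $t$ is a well-typed term of type $\tau$ built from $\Sigma$ and $\mathcal{K}\cup\mathcal{C}$. $\forall\mathcal{R}$ / $\exists\mathcal{L}$: from $\Sigma,h:\Gamma\vdash B[h\,\vec c/x]$ (resp. $\Sigma,h:\Gamma,B[h\,\vec c/x]\vdash C$) infer $\Sigma:\Gamma\vdash\forall x.B$ (resp. $\Sigma:\Gamma,\exists x.B\vdash C$), where $h\notin\Sigma$ is a fresh variable of suitable type and $\vec c$ lists $\mathrm{supp}(B)$. $\nabla\mathcal{L}$ / $\nabla\mathcal{R}$: from $\Sigma:\Gamma,B[a/x]\vdash C$ (resp. $\Sigma:\Gamma\vdash B[a/x]$) infer $\Sigma:\Gamma,\nabla x.B\vdash C$ (resp. $\Sigma:\Gamma\vdash\nabla x.B$), $a$ a nominal constant not in $\mathrm{supp}(B)$. $\unrhd\mathcal{L}$: from the (possibly infinite) family $\{\Sigma\theta:\Gamma\langle\theta\rangle\vdash C\langle\theta\rangle\mid\theta$ a solution to $s\unrhd t\}$ infer $\Sigma:\Gamma,s\unrhd t\vdash C$. $\unrhd\mathcal{R}$: $\Sigma:\Gamma\vdash s\unrhd t$ provided $s\unrhd t$ holds. $\mathit{def}\mathcal{L}$ / $\mathit{def}\mathcal{R}$ (for $p$ with clause body $B$ of any of the three kinds): from $\Sigma:\Gamma,B\,p\,\vec t\vdash C$ infer $\Sigma:\Gamma,p\,\vec t\vdash C$; from $\Sigma:\Gamma\vdash B\,p\,\vec t$ infer $\Sigma:\Gamma\vdash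 p\,\vec t$. $\mathcal{IL}$: if $p$ has clause $\forall\vec x.p\,\vec x\stackrel{\mu}{=}B\,p\,\vec x$ and $S$ is a term of the type of $p$ without nominal constants, from $\vec x:B\,S\,\vec x\vdash S\,\vec x$ and $\Sigma:\Gamma,S\,\vec t\vdash C$ infer $\Sigma:\Gamma,p\,\vec t\vdash C$. $\mathcal{CIR}$: if $p$ has clause $\forall\vec x.p\,\vec x\stackrel{\nu}{=}B\,p\,\vec x$ and $S$ as before, from $\Sigma:\Gamma\vdash S\,\vec t$ and $\vec x:S\,\vec x\vdash B\,S\,\vec x$ infer $\Sigma:\Gamma\vdash p\,\vec t$. Derivations are well-founded, possibly infinitely branching trees of rule instances. *)

(* Defs.v *)
(* Terms are intrinsically typed de Bruijn terms, with conversion as an explicit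
   relation.  Eigenvariables are the variables of the context of a term, so the
   scoping and freshness conditions on eigenvariables hold by typing. *)
From Stdlib Require Import List Permutation PeanoNat.
Import ListNotations.
Set Implicit Arguments.
Unset Strict Implicit.

(* Simple types in which o does not occur. *)
Inductive ity (T : Type) : Type :=
| IBase (b : T)
| IArr (a1 a2 : ity T).

Inductive ty (T : Type) : Type :=
| TBase (b : T)
| TO
| TArr (A1 A2 : ty T).
Arguments TO {T}.

Fixpoint inj {T : Type} (a : ity T) : ty T :=
  match a with
  | IBase b => TBase b
  | IArr a1 a2 => TArr (inj a1) (inj a2)
  end.

(* A non-logical constant has o-free argument types; it is a predicate when
   its target is o and a member of [con] when its target is a base type. *)
Record signature := Signature {
  sort : Type;
  sort_dec : forall a b : sort, {a = b} + {a <> b};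
  con : Type;
  cargs : con -> list (ity sort);
  ctgt : con -> sort;
  pred : Type;
  pargs : pred -> list (ity sort)
}.

Section Syntax.
Context {Sg : signature}.

Notation ity := (ity (sort Sg)).
Notation ty := (ty (sort Sg)).
Notation "A ⇒ B" := (@TArr (sort Sg) A B) (at level 55, right associativity).

Fixpoint arrs (As : list ity) (A : ty) : ty :=
  match As with [] => A | a :: As' => inj a ⇒ arrs As' A end.

Fixpoint iarrs (As : list ity) (b : ity) : ity :=
  match As with [] => b | a :: As' => IArr a (iarrs As' b) end.

Definition ity_dec : forall a b : ity, {a = b} + {a <> b}.
Proof. decide equality; apply sort_dec. Defined.

(* The nominal constants: a copy of nat at every o-free type. *)
Definition nom : Type := (ity * nat)%type.

Definition nom_dec : forall c d : nom, {c = d} + {c <> d}.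
Proof. decide equality; [apply Nat.eq_dec | apply ity_dec]. Defined.

Definition kst : Type := (con Sg + pred Sg)%type.

Definition kargs (k : kst) : list ity :=
  match k with inl f => cargs f | inr p => pargs p end.

Definition ktgt (k : kst) : ty :=
  match k with inl f => TBase (ctgt f) | inr _ => TO end.

Definition pty (p : pred Sg) : ty := arrs (pargs p) TO.

Inductive lcon : ty -> Type :=
| LTop : lcon TO
| LBot : lcon TO
| LAnd : lcon (TO ⇒ TO ⇒ TO)
| LOr : lcon (TO ⇒ TO ⇒ TO)
| LImp : lcon (TO ⇒ TO ⇒ TO)
| LAll (a : ity) : lcon ((inj a ⇒ TO) ⇒ TO)
| LEx (a : ity) : lcon ((inj a ⇒ TO) ⇒ TO)
| LNabla (a : ity) : lcon ((inj a ⇒ TO) ⇒ TO)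
| LNabs (As : list ity) (A : ty) : lcon (arrs As A ⇒ A ⇒ TO).

Inductive mem : list ty -> ty -> Type :=
| MZ (G : list ty) (A : ty) : mem (A :: G) A
| MS (G : list ty) (A B : ty) : mem G A -> mem (B :: G) A.

Inductive tm (G : list ty) : ty -> Type :=
| Var (A : ty) : mem G A -> tm G A
| Nom (c : nom) : tm G (inj (fst c))
| Kst (k : kst) : tm G (arrs (kargs k) (ktgt k))
| Log (A : ty) : lcon A -> tm G A
| App (A B : ty) : tm G (A ⇒ B) -> tm G A -> tm G B
| Lam (A B : ty) : tm (A :: G) B -> tm G (A ⇒ B).
Arguments Nom {G} c.
Arguments Kst {G} k.
Arguments Log {G A} _.

Notation form G := (tm G TO).

Definition ren (G G' : list ty) := forall A, mem G A -> mem G' A.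
Definition sub (G G' : list ty) := forall A, mem G A -> tm G' A.

Definition ren_up (G G' : list ty) (B : ty) (r : ren G G') :
    ren (B :: G) (B :: G') :=
  fun A v =>
    match v in mem H A0
      return match H with
             | [] => unit
             | B0 :: H0 => ren H0 G' -> mem (B0 :: G') A0
             end with
    | MZ _ _ => fun _ => MZ _ _
    | MS _ w => fun r' => MS _ (r' _ w)
    end r.

Fixpoint rename (G G' : list ty) (A : ty) (r : ren G G') (t : tm G A) : tm G' A :=
  match t in tm _ A0 return tm G' A0 with
  | Var v => Var (r _ v)
  | Nom c => Nom c
  | Kst k => Kst k
  | Log l => Log l
  | App t1 t2 => App (rename r t1) (rename r t2)
  | Lam b => Lam (rename (ren_up r) b)
  end.

Definition ren_shift (G : list ty) (B : ty) : ren G (B :: G) := fun A v => MS B v.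

Definition wk (G : list ty) (B A : ty) (t : tm G A) : tm (B :: G) A :=
  rename (@ren_shift G B) t.

Definition ren_nil (G : list ty) : ren [] G :=
  fun A v =>
    match v in mem H A0
      return match H with [] => mem G A0 | _ => unit end with
    | MZ _ _ => tt
    | MS _ _ => tt
    end.

(* A closed term in an arbitrary context. *)
Definition wk0 (G : list ty) (A : ty) (t : tm [] A) : tm G A :=
  rename (@ren_nil G) t.

Definition scons (G G' : list ty) (B : ty) (t : tm G' B) (s : sub G G') :
    sub (B :: G) G' :=
  fun A v =>
    match v in mem H A0
      return match H with
             | [] => unit
             | B0 :: H0 => tm G' B0 -> sub H0 G' -> tm G' A0
             end with
    | MZ _ _ => fun t' _ => t'
    | MS _ w => fun _ s' => s' _ w
    end t s.

Definition sub_up (G G' : list ty) (B : ty) (s : sub G G') : sub (B :: G) (B :: G') :=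
  scons (Var (MZ G' B)) (fun A v => wk B (s A v)).

Fixpoint subst (G G' : list ty) (A : ty) (s : sub G G') (t : tm G A) : tm G' A :=
  match t in tm _ A0 return tm G' A0 with
  | Var v => s _ v
  | Nom c => Nom c
  | Kst k => Kst k
  | Log l => Log l
  | App t1 t2 => App (subst s t1) (subst s t2)
  | Lam b => Lam (subst (sub_up s) b)
  end.

Definition inst (G : list ty) (B A : ty) (b : tm (B :: G) A) (t : tm G B) : tm G A :=
  subst (scons t (fun A v => Var v)) b.

(* alpha-equivalence is syntactic equality here. *)
Inductive conv : forall (G : list ty) (A : ty), tm G A -> tm G A -> Prop :=
| conv_refl G A (t : tm G A) : conv t t
| conv_sym G A (t u : tm G A) : conv t u -> conv u t
| conv_trans G A (t u v : tm G A) : conv t u -> conv u v -> conv t v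
| conv_app G A B (t t' : tm G (A ⇒ B)) (u u' : tm G A) :
    conv t t' -> conv u u' -> conv (App t u) (App t' u')
| conv_lam G A B (b b' : tm (A :: G) B) : conv b b' -> conv (Lam b) (Lam b')
| conv_beta G A B (b : tm (A :: G) B) (u : tm G A) :
    conv (App (Lam b) u) (inst b u)
| conv_eta G A B (t : tm G (A ⇒ B)) :
    conv (Lam (App (wk A t) (Var (MZ G A)))) t.

Inductive atom : Type :=
| ANom (c : nom)
| AKst (k : kst).

Fixpoint occ (x : atom) (G : list ty) (A : ty) (t : tm G A) : Prop :=
  match t with
  | Var _ => False
  | Nom c => x = ANom c
  | Kst k => x = AKst k
  | Log _ => False
  | App t1 t2 => occ x t1 \/ occ x t2
  | Lam b => occ x b
  end.

(* Terms are taken modulo conversion, so a constant occurs in a term when it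
   occurs in all its representatives; since reduction creates no occurrence
   of a constant, this is occurrence in the lambda-normal form. *)
Definition occurs (x : atom) (G : list ty) (A : ty) (t : tm G A) : Prop :=
  forall u : tm G A, conv t u -> occ x u.

Definition in_supp (c : nom) (G : list ty) (A : ty) (t : tm G A) : Prop :=
  occurs (ANom c) t.

Definition no_nom (G : list ty) (A : ty) (t : tm G A) : Prop :=
  forall c, ~ in_supp c t.

Definition lists_supp (cs : list nom) (G : list ty) (A : ty) (t : tm G A) : Prop :=
  NoDup cs /\ forall c, In c cs <-> in_supp c t.

Definition in_supp_sub (c : nom) (G G' : list ty) (s : sub G G') : Prop :=
  exists (A : ty) (v : mem G A), in_supp c (s A v).

Record perm := Perm {
  pfun : ity -> nat -> nat;
  pinv : ity -> nat -> nat;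
  pfunK : forall a n, pinv a (pfun a n) = n;
  pinvK : forall a n, pfun a (pinv a n) = n;
  pfinite : exists L : list nom, forall a n, ~ In (a, n) L -> pfun a n = n
}.

Definition pact (pi : perm) (c : nom) : nom := (fst c, pfun pi (fst c) (snd c)).

Fixpoint permute (pi : perm) (G : list ty) (A : ty) (t : tm G A) : tm G A :=
  match t in tm _ A0 return tm G A0 with
  | Var v => Var v
  | Nom c => (Nom (pact pi c) : tm G (inj (fst c)))
  | Kst k => Kst k
  | Log l => Log l
  | App t1 t2 => App (permute pi t1) (permute pi t2)
  | Lam b => Lam (permute pi b)
  end.

Definition eqvt (G : list ty) (A : ty) (t t' : tm G A) : Prop :=
  exists pi, conv t (permute pi t').

Definition avoids (pi : perm) (G G' : list ty) (th : sub G G') (A : ty) (t : tm G A) :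
    Prop :=
  forall c, in_supp c t -> ~ in_supp_sub (pact pi c) th.

(* [ncas th t u]: u is a possible value of t<th>, which is determined only up
   to the choice of the permutation. *)
Definition ncas (G G' : list ty) (th : sub G G') (A : ty) (t : tm G A) (u : tm G' A) :
    Prop :=
  exists pi, avoids pi th t /\ u = subst th (permute pi t).

Definition Top {G} : form G := Log LTop.
Definition Bot {G} : form G := Log LBot.
Definition And {G} (B C : form G) : form G := App (App (Log LAnd) B) C.
Definition Or {G} (B C : form G) : form G := App (App (Log LOr) B) C.
Definition Imp {G} (B C : form G) : form G := App (App (Log LImp) B) C.
Definition All {G} {a : ity} (B : form (inj a :: G)) : form G :=
  App (Log (LAll a)) (Lam B).
Definition Ex {G} {a : ity} (B : form (inj a :: G)) : form G :=
  App (Log (LEx a)) (Lam B).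
Definition Nabla {G} {a : ity} (B : form (inj a :: G)) : form G :=
  App (Log (LNabla a)) (Lam B).
Definition Nabs {G} {As : list ity} {A : ty} (s : tm G (arrs As A)) (t : tm G A) :
    form G :=
  App (App (Log (LNabs As A)) s) t.

Fixpoint repl (c : nom) (G : list ty) (A : ty) (t : tm G A) :
    mem G (inj (fst c)) -> tm G A :=
  match t in tm _ A0 return mem G (inj (fst c)) -> tm G A0 with
  | Var w => fun _ => Var w
  | Nom d => fun v =>
      match nom_dec c d with
      | left e => Var (eq_rect c (fun d0 => mem G (inj (fst d0))) v d e)
      | right _ => Nom d
      end
  | Kst k => fun _ => Kst k
  | Log l => fun _ => Log l
  | App t1 t2 => fun v => App (repl t1 v) (repl t2 v)
  | Lam b => fun v => Lam (repl b (MS _ v))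
  end.

Definition lam_nom (c : nom) (G : list ty) (A : ty) (t : tm G A) :
    tm G (inj (fst c) ⇒ A) :=
  Lam (repl (wk (inj (fst c)) t) (MZ G (inj (fst c)))).

Fixpoint lam_noms (cs : list nom) (G : list ty) (A : ty) (t : tm G A) :
    tm G (arrs (map fst cs) A) :=
  match cs return tm G (arrs (map fst cs) A) with
  | [] => t
  | c :: cs' => lam_nom c (lam_noms cs' t)
  end.

Definition nabs_holds (G : list ty) (As : list ity) (A : ty)
    (s : tm G (arrs As A)) (t : tm G A) : Prop :=
  exists (cs : list nom) (e : map fst cs = As),
    NoDup cs /\
    conv s (eq_rect (map fst cs) (fun l => tm G (arrs l A)) (lam_noms cs t) As e).

Definition solution (G G' : list ty) (th : sub G G') (As : list ity) (A : ty)
    (s : tm G (arrs As A)) (t : tm G A) : Prop :=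
  exists pi, avoids pi th (Nabs s t) /\
    nabs_holds (subst th (permute pi s)) (subst th (permute pi t)).

Inductive tms (G : list ty) : list ity -> Type :=
| tnil : tms G []
| tcons (a : ity) (As : list ity) : tm G (inj a) -> tms G As -> tms G (a :: As).
Arguments tnil {G}.

Fixpoint tms_map (G G' : list ty) (f : forall A, tm G A -> tm G' A)
    (As : list ity) (ts : tms G As) : tms G' As :=
  match ts with
  | tnil => tnil
  | tcons t ts' => tcons (f _ t) (tms_map f ts')
  end.

Fixpoint tms_all (G : list ty) (P : forall A, tm G A -> Prop)
    (As : list ity) (ts : tms G As) : Prop :=
  match ts with
  | tnil => True
  | tcons t ts' => P _ t /\ tms_all P ts'
  end.

Fixpoint apps (G : list ty) (As : list ity) (A : ty) (t : tm G (arrs As A))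
    (ts : tms G As) : tm G A :=
  match ts in tms _ As0 return tm G (arrs As0 A) -> tm G A with
  | tnil => fun t => t
  | tcons u us => fun t => apps (App t u) us
  end t.

(* The context obtained by going under binders of types As, outermost first. *)
Fixpoint ext (As : list ity) (G : list ty) : list ty :=
  match As with [] => G | a :: As' => ext As' (inj a :: G) end.

Fixpoint ren_ext (As : list ity) : forall G : list ty, ren G (ext As G) :=
  match As return forall G, ren G (ext As G) with
  | [] => fun G A v => v
  | a :: As' => fun G A v => ren_ext As' (MS (inj a) v)
  end.

Fixpoint ren_ups (As : list ity) :
    forall G G' : list ty, ren G G' -> ren (ext As G) (ext As G') :=
  match As return forall G G', ren G G' -> ren (ext As G) (ext As G') with
  | [] => fun G G' r => r
  | a :: As' => fun G G' r => @ren_ups As' _ _ (ren_up (B := inj a) r)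
  end.
Arguments ren_ups As {G G'} r.

Fixpoint vars (As : list ity) : forall G : list ty, tms (ext As G) As :=
  match As return forall G, tms (ext As G) As with
  | [] => fun G => tnil
  | a :: As' => fun G =>
      tcons (Var (ren_ext As' (MZ G (inj a)))) (vars As' (inj a :: G))
  end.

Fixpoint lams (As : list ity) (A : ty) :
    forall G : list ty, tm (ext As G) A -> tm G (arrs As A) :=
  match As return forall G, tm (ext As G) A -> tm G (arrs As A) with
  | [] => fun G t => t
  | a :: As' => fun G t => Lam (lams (G := inj a :: G) t)
  end.

Fixpoint Exs (As : list ity) : forall G : list ty, form (ext As G) -> form G :=
  match As return forall G, form (ext As G) -> form G with
  | [] => fun G B => B
  | a :: As' => fun G B => Ex (a := a) (Exs (G := inj a :: G) B)
  end.

Fixpoint Nablas (As : list ity) : forall G : list ty, form (ext As G) -> form G :=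
  match As return forall G, form (ext As G) -> form G with
  | [] => fun G B => B
  | a :: As' => fun G B => Nabla (a := a) (Nablas (G := inj a :: G) B)
  end.

Fixpoint Ors {G} (Bs : list (form G)) : form G :=
  match Bs with
  | [] => Bot
  | [B] => B
  | B :: Bs' => Or B (Ors Bs')
  end.

Definition Pred {G} (p : pred Sg) : tm G (pty p) := Kst (inr p).

(* [has_lvl lvl B n]: the lambda-normal form of B has level n. *)
Inductive has_lvl (lvl : pred Sg -> nat) : forall G : list ty, form G -> nat -> Prop :=
| lvl_conv G (B B' : form G) n : conv B B' -> has_lvl lvl B' n -> has_lvl lvl B n
| lvl_pred G p (ts : tms G (pargs p)) : has_lvl lvl (apps (Pred p) ts) (lvl p)
| lvl_top G : has_lvl lvl (@Top G) 0
| lvl_bot G : has_lvl lvl (@Bot G) 0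
| lvl_nabs G As A (s : tm G (arrs As A)) (t : tm G A) : has_lvl lvl (Nabs s t) 0
| lvl_and G (B C : form G) m n :
    has_lvl lvl B m -> has_lvl lvl C n -> has_lvl lvl (And B C) (max m n)
| lvl_or G (B C : form G) m n :
    has_lvl lvl B m -> has_lvl lvl C n -> has_lvl lvl (Or B C) (max m n)
| lvl_imp G (B C : form G) m n :
    has_lvl lvl B m -> has_lvl lvl C n -> has_lvl lvl (Imp B C) (max (m + 1) n)
| lvl_all G a (B : form (inj a :: G)) n : has_lvl lvl B n -> has_lvl lvl (All B) n
| lvl_ex G a (B : form (inj a :: G)) n : has_lvl lvl B n -> has_lvl lvl (Ex B) n
| lvl_nabla G a (B : form (inj a :: G)) n : has_lvl lvl B n -> has_lvl lvl (Nabla B) n.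

(* lvl (B (\x. T) x) < lvl p; clause bodies are closed, the bound variables
   xs of the clause being those of the context. *)
Definition stratified (lvl : pred Sg -> nat) (p : pred Sg) (xs : list ity)
    (B : tm [] (pty p ⇒ arrs xs TO)) : Prop :=
  exists n,
    has_lvl lvl
      (apps (App (wk0 (ext xs []) B) (lams (As := pargs p) Top)) (vars xs [])) n
    /\ n < lvl p.

Inductive kind := Plain | Mu | Nu.

(* forall xs. p xs = B p xs *)
Record clause := Clause {
  cl_pred : pred Sg;
  cl_kind : kind;
  cl_body : tm [] (pty cl_pred ⇒ pty cl_pred)
}.

Definition gdef := list clause.

Record wf_clause (lvl : pred Sg -> nat) (c : clause) : Prop := {
  wfc_pred : ~ occurs (AKst (inr (cl_pred c))) (cl_body c);
  wfc_nom : no_nom (cl_body c);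
  wfc_lvl : stratified lvl (cl_body c)
}.

Record wf_gdef (lvl : pred Sg -> nat) (D : gdef) : Prop := {
  wfd_uniq : NoDup (map cl_pred D);
  wfd_clause : forall c, In c D -> wf_clause lvl c
}.

(* forall xs. (nabla zs. p ts) = B p xs *)
Record pclause (p : pred Sg) := PClause {
  pc_xs : list ity;
  pc_zs : list ity;
  pc_ts : tms (ext pc_zs (ext pc_xs [])) (pargs p);
  pc_body : tm [] (pty p ⇒ arrs pc_xs TO)
}.

Record wf_pclause (lvl : pred Sg -> nat) (p : pred Sg) (c : pclause p) : Prop := {
  wfp_ts : tms_all (fun A t => no_nom t) (pc_ts c);
  wfp_pred : ~ occurs (AKst (inr p)) (pc_body c);
  wfp_nom : no_nom (pc_body c);
  wfp_lvl : stratified lvl (pc_body c)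
}.

(* k ts, for a constant k with the same argument types as p. *)
Definition kapp {G} (p : pred Sg) (k : kst) (e : pargs p = kargs k)
    (ts : tms G (pargs p)) : tm G (ktgt k) :=
  apps (Kst k) (eq_rect (pargs p) (tms G) ts (kargs k) e).

(* exists xs. ((\zs. k ts) |> k ys) /\ B P xs, with P and ys free. *)
Definition tr_disj (p : pred Sg) (k : kst) (e : pargs p = kargs k) (c : pclause p) :
    form (ext (pargs p) [pty p]) :=
  let H := ext (pargs p) [pty p] in
  let rho : ren H (ext (pc_xs c) H) := ren_ext (pc_xs c) (G := H) in
  let ts := tms_map
              (fun A => rename (ren_ups (pc_zs c) (ren_ups (pc_xs c) (@ren_nil H))))
              (pc_ts c) in
  let ys := tms_map (fun A => rename rho) (vars (pargs p) [pty p]) in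
  let P := Var (rho _ (ren_ext (pargs p) (MZ [] (pty p)))) in
  Exs (As := pc_xs c)
    (And (Nabs (lams (As := pc_zs c) (kapp e ts)) (kapp e ys))
         (apps (App (wk0 _ (pc_body c)) P) (vars (pc_xs c) H))).

Definition translate (p : pred Sg) (k : kst) (e : pargs p = kargs k)
    (cs : list (pclause p)) : tm [] (pty p ⇒ pty p) :=
  Lam (lams (As := pargs p) (Ors (map (tr_disj e) cs))).

(* k occurs neither in the pattern-based clauses for p nor in D. *)
Record new_kst (p : pred Sg) (cs : list (pclause p)) (D : gdef) (k : kst) : Prop := {
  new_pred : k <> inr p;
  new_defd : forall c, In c D -> k <> inr (cl_pred c);
  new_body : forall c, In c D -> ~ occurs (AKst k) (cl_body c);
  new_ts : forall c, In c cs -> tms_all (fun A t => ~ occurs (AKst k) t) (pc_ts c);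
  new_pbody : forall c, In c cs -> ~ occurs (AKst k) (pc_body c)
}.

(* Eigenvariables have o-free types. *)
Definition eigen (G : list ty) : Prop := Forall (fun A => exists a, A = inj a) G.

Fixpoint app_noms {G} (cs : list nom) (a : ity) :
    tm G (inj (iarrs (map fst cs) a)) -> tm G (inj a) :=
  match cs return tm G (inj (iarrs (map fst cs) a)) -> tm G (inj a) with
  | [] => fun t => t
  | c :: cs' => fun t => app_noms (cs := cs') (App t (Nom c))
  end.

(* B[h cs/x], where h is the variable added to the context. *)
Definition raise {G} (cs : list nom) (a : ity) (B : form (inj a :: G)) :
    form (inj (iarrs (map fst cs) a) :: G) :=
  subst (scons (app_noms (cs := cs) (Var (MZ G _))) (fun A v => Var (MS _ v))) B.

(* A sequent Sigma : Gamma |- C is given by a context (Sigma), a list of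
   formulas in that context and a formula in that context; d_eq identifies
   sequents that agree up to the order of Gamma and conversion.  In d_nabsL
   the context Sigma.theta is the codomain of th, and Gs, Cs are values of
   Gamma<theta> and C<theta>. *)
Inductive der (D : gdef) : forall G : list ty, list (form G) -> form G -> Prop :=
| d_eq G (Gm Gm1 Gm' : list (form G)) (C C' : form G) :
    Permutation Gm Gm1 -> Forall2 (fun B B' => conv B B') Gm1 Gm' -> conv C C' ->
    der D Gm C -> der D Gm' C'
| d_id G Gm (B B' : form G) : eqvt B B' -> der D (B :: Gm) B'
| d_cut G Gm Dl (B C : form G) :
    der D Gm B -> der D (B :: Dl) C -> der D (Gm ++ Dl) C
| d_cL G Gm (B C : form G) : der D (B :: B :: Gm) C -> der D (B :: Gm) C
| d_botL G Gm (C : form G) : der D (Bot :: Gm) C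
| d_topR G (Gm : list (form G)) : der D Gm Top
| d_orL G Gm (B B' C : form G) :
    der D (B :: Gm) C -> der D (B' :: Gm) C -> der D (Or B B' :: Gm) C
| d_orR1 G Gm (B B' : form G) : der D Gm B -> der D Gm (Or B B')
| d_orR2 G Gm (B B' : form G) : der D Gm B' -> der D Gm (Or B B')
| d_andL1 G Gm (B B' C : form G) : der D (B :: Gm) C -> der D (And B B' :: Gm) C
| d_andL2 G Gm (B B' C : form G) : der D (B' :: Gm) C -> der D (And B B' :: Gm) C
| d_andR G Gm (B C : form G) : der D Gm B -> der D Gm C -> der D Gm (And B C)
| d_impL G Gm (B B' C : form G) :
    der D Gm B -> der D (B' :: Gm) C -> der D (Imp B B' :: Gm) C
| d_impR G Gm (B C : form G) : der D (B :: Gm) C -> der D Gm (Imp B C)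
| d_allL G Gm a (B : form (inj a :: G)) (t : tm G (inj a)) (C : form G) :
    der D (inst B t :: Gm) C -> der D (All B :: Gm) C
| d_exR G Gm a (B : form (inj a :: G)) (t : tm G (inj a)) :
    der D Gm (inst B t) -> der D Gm (Ex B)
| d_allR G Gm a (B : form (inj a :: G)) (cs : list nom) :
    lists_supp cs B ->
    der D (map (fun F => wk _ F) Gm) (raise cs B) -> der D Gm (All B)
| d_exL G Gm a (B : form (inj a :: G)) (cs : list nom) (C : form G) :
    lists_supp cs B ->
    der D (raise cs B :: map (fun F => wk _ F) Gm) (wk _ C) -> der D (Ex B :: Gm) C
| d_nablaL G Gm (c : nom) (B : form (inj (fst c) :: G)) (C : form G) :
    ~ in_supp c B -> der D (inst B (Nom c) :: Gm) C -> der D (Nabla B :: Gm) C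
| d_nablaR G Gm (c : nom) (B : form (inj (fst c) :: G)) :
    ~ in_supp c B -> der D Gm (inst B (Nom c)) -> der D Gm (Nabla B)
| d_nabsL G (Gm : list (form G)) As A (s : tm G (arrs As A)) (t : tm G A) (C : form G)
    (Gs : forall G', sub G G' -> list (form G')) (Cs : forall G', sub G G' -> form G') :
    (forall G' (th : sub G G'), eigen G' -> solution th s t ->
       Forall2 (fun B B' => ncas th B B') Gm (Gs G' th)) ->
    (forall G' (th : sub G G'), eigen G' -> solution th s t -> ncas th C (Cs G' th)) ->
    (forall G' (th : sub G G'), eigen G' -> solution th s t ->
       der D (Gs G' th) (Cs G' th)) ->
    der D (Nabs s t :: Gm) C
| d_nabsR G Gm As A (s : tm G (arrs As A)) (t : tm G A) :
    nabs_holds s t -> der D Gm (Nabs s t)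
| d_defL G Gm p k B (ts : tms G (pargs p)) (C : form G) :
    In (@Clause p k B) D ->
    der D (apps (App (wk0 G B) (Pred p)) ts :: Gm) C ->
    der D (apps (Pred p) ts :: Gm) C
| d_defR G Gm p k B (ts : tms G (pargs p)) :
    In (@Clause p k B) D ->
    der D Gm (apps (App (wk0 G B) (Pred p)) ts) ->
    der D Gm (apps (Pred p) ts)
| d_IL G Gm p B (S : tm [] (pty p)) (ts : tms G (pargs p)) (C : form G) :
    In (@Clause p Mu B) D -> no_nom S ->
    der D [apps (App (wk0 (ext (pargs p) []) B) (wk0 _ S)) (vars (pargs p) [])]
          (apps (wk0 _ S) (vars (pargs p) [])) ->
    der D (apps (wk0 G S) ts :: Gm) C ->
    der D (apps (Pred p) ts :: Gm) C
| d_CIR G Gm p B (S : tm [] (pty p)) (ts : tms G (pargs p)) :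
    In (@Clause p Nu B) D -> no_nom S ->
    der D Gm (apps (wk0 G S) ts) ->
    der D [apps (wk0 (ext (pargs p) []) S) (vars (pargs p) [])]
          (apps (App (wk0 _ B) (wk0 _ S)) (vars (pargs p) [])) ->
    der D Gm (apps (Pred p) ts).

End Syntax.

Arguments gdef Sg : clear implicits.
Arguments kst Sg : clear implicits.
Arguments Nom {Sg G} c.
Arguments Kst {Sg G} k.
Arguments Log {Sg G A} _.
Arguments tnil {Sg G}.
Arguments ren_ups {Sg} As {G G'} r.

(* Main.v *)
(** By the primitive induction rule with invariant S it suffices to derive S y
    from each translated disjunct.  Nothing there contains nominal constants, so
    the existential variables are introduced unraised, and every solution theta
    of the nominal abstraction satisfies
    lambda z. p' (t theta) = lambda c. p' (y theta) up to conversion.  Constants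
    are injective modulo conversion (shown by normalization by evaluation), so
    p' may be replaced by S: then nabla z. S (t theta) is nabla c. S (y theta),
    which yields S (y theta).  The left-hand formula is the instance under theta
    of the premise for that clause; to instantiate it, the premise is closed
    under universal quantifiers, weakened to the context of theta, and cut in.
    Weakening is proved by induction on derivations. *)
Require Import Defs.
From Stdlib Require Import List Permutation PeanoNat Lia Classical.
From Stdlib Require Import FunctionalExtensionality ClassicalEpsilon Eqdep_dec.
Import ListNotations.
Set Implicit Arguments.
Unset Strict Implicit.

Section Theory.
Context {Sg : signature}.

Notation ity := (ity (sort Sg)).
Notation ty := (ty (sort Sg)).
Notation nom := (@nom Sg).
Notation kst := (kst Sg).
Notation pred := (pred Sg).
Notation perm := (@perm Sg).
Notation form G := (@tm Sg G TO).
Notation "A ⇒ B" := (@TArr (sort Sg) A B) (at level 55, right associativity).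

(** Terms are not quotiented by conversion, and this shapes the proof. A nominal constant lies in a
    support when no representative avoids it, so absence from the support yields, classically, one
    representative per constant. Injectivity of p' modulo conversion comes from a model rather than
    from confluence. General substitutions may change supports, on which raising and the side
    conditions of the quantifier and nabla rules depend; derivations are therefore transported only
    along renamings with suitable left inverses. Even so, in the rule for nominal abstraction the
    permutations chosen before and after weakening may differ; they are reconciled by cuts with the
    identity rule, which holds up to permutation. Finally, S may replace p' because injectivity
    turns the equation of abstractions into: t theta is y theta with the constants c replaced by the
    variables z. This replacement leaves S alone, since S has no nominal constants. *)

Lemma mem_case (G : list ty) (B : ty) (P : forall A, mem (B :: G) A -> Prop) :
  P B (MZ G B) -> (forall A (w : mem G A), P A (MS B w)) -> forall A v, P A v.
Proof.
  intros HZ HS A v.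
  refine (match v as v0 in mem H A0 return
    match H return mem H A0 -> Prop with
    | [] => fun _ => True
    | B0 :: H0 => fun v => forall P : forall A, mem (B0 :: H0) A -> Prop,
        P B0 (MZ H0 B0) -> (forall A (w : mem H0 A), P A (MS B0 w)) -> P A0 v
    end v0 with MZ _ _ => _ | MS _ _ => _ end P HZ HS); auto.
Qed.

(** * Simultaneous substitution of variables and nominal constants *)

Definition nsub (G : list ty) := forall c : nom, @tm Sg G (inj (fst c)).

(** Nominal constants go to arbitrary terms, not merely to constants, because [repl] turns one into
    a variable. *)
Fixpoint hsubst (G G' : list ty) (A : ty) (s : sub G G') (n : nsub G')
    (t : tm G A) : tm G' A :=
  match t in tm _ A0 return tm G' A0 with
  | Var v => s _ v
  | Nom c => n c
  | Kst k => Kst k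
  | Log l => Log l
  | App t1 t2 => App (hsubst s n t1) (hsubst s n t2)
  | Lam b => Lam (hsubst (sub_up s) (fun c => wk _ (n c)) b)
  end.

Definition Noms (G : list ty) : nsub G := fun c => Nom c.
Definition Vars (G : list ty) : sub G G := fun A v => Var v.

Lemma hsubst_ext_occ (G G' : list ty) (A : ty) (t : tm G A) :
  forall (s s' : sub G G') (n n' : nsub G'),
  (forall A v, s A v = s' A v) ->
  (forall c, occ (ANom c) t -> n c = n' c) -> hsubst s n t = hsubst s' n' t.
Proof.
  revert G'; induction t; intros G' s s' n n' Hs Hn; simpl in *; auto.
  - f_equal; [apply IHt1 | apply IHt2]; auto.
  - f_equal; apply IHt; [| intros c Hc; rewrite Hn; auto].
    apply mem_case; [reflexivity |].
    intros; simpl; rewrite Hs; reflexivity.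
Qed.

Lemma hsubst_ext (G G' : list ty) (A : ty) (t : tm G A) (s s' : sub G G')
    (n n' : nsub G') :
  (forall A v, s A v = s' A v) -> (forall c, n c = n' c) ->
  hsubst s n t = hsubst s' n' t.
Proof. intros; apply hsubst_ext_occ; auto. Qed.

Lemma rename_hsubst (G G' : list ty) (A : ty) (t : tm G A) :
  forall r : ren G G', rename r t = hsubst (fun A v => Var (r A v)) (@Noms G') t.
Proof.
  revert G'; induction t; intros G' r; simpl; auto.
  - rewrite IHt1, IHt2; reflexivity.
  - rewrite IHt; f_equal; apply hsubst_ext; [| reflexivity].
    apply mem_case; reflexivity.
Qed.

Lemma subst_hsubst (G G' : list ty) (A : ty) (t : tm G A) :
  forall s : sub G G', subst s t = hsubst s (@Noms G') t.
Proof.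
  revert G'; induction t; intros G' s; simpl; auto.
  - rewrite IHt1, IHt2; reflexivity.
  - rewrite IHt; f_equal; apply hsubst_ext; reflexivity.
Qed.

Lemma permute_hsubst (pi : perm) (G : list ty) (A : ty) (t : tm G A) :
  permute pi t = hsubst (@Vars G) (fun c => @Nom Sg G (pact pi c)) t.
Proof.
  induction t; simpl; auto.
  - rewrite IHt1, IHt2; reflexivity.
  - rewrite IHt; f_equal; apply hsubst_ext; [| reflexivity].
    apply mem_case; reflexivity.
Qed.

Definition repl_nsub (c : nom) (G : list ty) (v : mem G (inj (fst c))) : nsub G :=
  fun d => match nom_dec c d with
      | left e => Var (eq_rect c (fun d0 => mem G (inj (fst d0))) v d e)
      | right _ => Nom d
      end.

Lemma repl_hsubst (c : nom) (G : list ty) (A : ty) (t : tm G A)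
    (v : mem G (inj (fst c))) :
  repl t v = hsubst (@Vars G) (repl_nsub v) t.
Proof.
  induction t; simpl; auto.
  - rewrite IHt1, IHt2; reflexivity.
  - rewrite IHt; f_equal; apply hsubst_ext.
    + apply mem_case; reflexivity.
    + intros d; unfold repl_nsub; destruct (nom_dec c d) as [e | e]; [| reflexivity].
      destruct e; reflexivity.
Qed.

Lemma hsubst_rename (G1 G2 : list ty) (A : ty) (t : tm G1 A) :
  forall (G3 : list ty) (r : ren G1 G2) (s : sub G2 G3) (n : nsub G3),
  hsubst s n (rename r t) = hsubst (fun A v => s A (r A v)) n t.
Proof.
  revert G2; induction t; intros G2 G3 r s n; simpl; auto.
  - rewrite IHt1, IHt2; reflexivity.
  - rewrite IHt; f_equal; apply hsubst_ext; [| reflexivity].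
    apply mem_case; reflexivity.
Qed.

Lemma rename_rename (G1 G2 G3 : list ty) (A : ty) (t : tm G1 A)
    (r : ren G1 G2) (r' : ren G2 G3) :
  rename r' (rename r t) = rename (fun A v => r' A (r A v)) t.
Proof. rewrite (rename_hsubst (rename r t)), hsubst_rename, rename_hsubst; reflexivity. Qed.

Lemma rename_wk (G1 G2 : list ty) (A B : ty) (t : tm G1 A) (r : ren G1 G2) :
  rename (ren_up r) (wk B t) = wk B (rename r t).
Proof. unfold wk; rewrite !rename_rename; reflexivity. Qed.

Lemma rename_hsubst_comp (G1 G2 : list ty) (A : ty) (t : tm G1 A) :
  forall (G3 : list ty) (s : sub G1 G2) (n : nsub G2) (r : ren G2 G3),
  rename r (hsubst s n t) =
  hsubst (fun A v => rename r (s A v)) (fun c => rename r (n c)) t.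
Proof.
  revert G2; induction t; intros G2 G3 s n r; simpl; auto.
  - rewrite IHt1, IHt2; reflexivity.
  - rewrite IHt; f_equal; apply hsubst_ext.
    + apply mem_case; [reflexivity |].
      intros; apply rename_wk.
    + intros c; apply rename_wk.
Qed.

Lemma hsubst_wk (G1 G2 : list ty) (A B : ty) (t : tm G1 A) (s : sub G1 G2)
    (n : nsub G2) :
  hsubst (sub_up s) (fun c => wk B (n c)) (wk B t) = wk B (hsubst s n t).
Proof. unfold wk; rewrite hsubst_rename, rename_hsubst_comp; reflexivity. Qed.

(** Composition with renamings on either side comes first: it gives the commutation with weakening
    needed below a [Lam]. *)
Lemma hsubst_hsubst (G1 G2 : list ty) (A : ty) (t : tm G1 A) :
  forall (G3 : list ty) (s : sub G1 G2) (n : nsub G2) (s' : sub G2 G3) (n' : nsub G3),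
  hsubst s' n' (hsubst s n t) =
  hsubst (fun A v => hsubst s' n' (s A v)) (fun c => hsubst s' n' (n c)) t.
Proof.
  revert G2; induction t; intros G2 G3 s n s' n'; simpl; auto.
  - rewrite IHt1, IHt2; reflexivity.
  - rewrite IHt; f_equal; apply hsubst_ext.
    + apply mem_case; [reflexivity |].
      intros; apply hsubst_wk.
    + intros c; apply hsubst_wk.
Qed.

Lemma hsubst_id (G : list ty) (A : ty) (t : tm G A) :
  hsubst (@Vars G) (@Noms G) t = t.
Proof.
  induction t; simpl; auto.
  - rewrite IHt1, IHt2; reflexivity.
  - f_equal; etransitivity; [| exact IHt]; apply hsubst_ext; [| reflexivity].
    apply mem_case; reflexivity.
Qed.

Lemma hsubst_id_ext (G : list ty) (A : ty) (t : tm G A) (s : sub G G) (n : nsub G) :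
  (forall A v, s A v = Var v) -> (forall c, n c = Nom c) -> hsubst s n t = t.
Proof.
  intros Hs Hn; etransitivity; [| apply hsubst_id]; apply hsubst_ext; auto.
Qed.

(* Every traversal of terms is an instance of [hsubst], so equations between
   their composites reduce to equations on variables and nominal constants. *)
Ltac to_hsubst :=
  unfold wk0, inst, wk;
  repeat (rewrite rename_hsubst || rewrite subst_hsubst || rewrite permute_hsubst
          || rewrite repl_hsubst || rewrite hsubst_hsubst).

Lemma hsubst_inst (G1 G2 : list ty) (A B : ty) (b : tm (A :: G1) B) (u : tm G1 A)
    (s : sub G1 G2) (n : nsub G2) :
  hsubst s n (inst b u) =
  inst (hsubst (sub_up s) (fun c => wk A (n c)) b) (hsubst s n u).
Proof.
  to_hsubst; apply hsubst_ext.
  - apply mem_case; [reflexivity |]; intros C w; simpl.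
    unfold wk; rewrite hsubst_rename; symmetry; apply hsubst_id_ext; reflexivity.
  - intros c; simpl; symmetry; unfold wk; rewrite hsubst_rename.
    apply hsubst_id_ext; reflexivity.
Qed.

Lemma conv_hsubst (G : list ty) (A : ty) (t u : tm G A) :
  conv t u -> forall (G' : list ty) (s : sub G G') (n : nsub G'),
  conv (hsubst s n t) (hsubst s n u).
Proof.
  induction 1; intros G' s n; simpl.
  - apply conv_refl.
  - apply conv_sym; auto.
  - eapply conv_trans; eauto.
  - apply conv_app; auto.
  - apply conv_lam; auto.
  - rewrite hsubst_inst; apply conv_beta.
  - rewrite hsubst_wk; apply conv_eta.
Qed.

Lemma conv_rename (G G' : list ty) (A : ty) (t u : tm G A) (r : ren G G') :
  conv t u -> conv (rename r t) (rename r u).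
Proof. rewrite !rename_hsubst; intros; apply conv_hsubst; auto. Qed.

Lemma conv_subst (G G' : list ty) (A : ty) (t u : tm G A) (s : sub G G') :
  conv t u -> conv (subst s t) (subst s u).
Proof. rewrite !subst_hsubst; intros; apply conv_hsubst; auto. Qed.

Lemma hsubst_conv_pointwise (G : list ty) (A : ty) (t : tm G A) :
  forall (G' : list ty) (s s' : sub G G') (n n' : nsub G'),
  (forall A v, conv (s A v) (s' A v)) -> (forall c, conv (n c) (n' c)) ->
  conv (hsubst s n t) (hsubst s' n' t).
Proof.
  induction t; intros G' s s' n n' Hs Hn; simpl; auto using conv_refl.
  - apply conv_app; auto.
  - apply conv_lam, IHt.
    + apply mem_case; [apply conv_refl |]; intros; apply conv_rename; auto.
    + intros c; apply conv_rename; auto.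
Qed.

Lemma conv_eq (G : list ty) (A : ty) (t u : tm G A) : t = u -> conv t u.
Proof. intros ->; apply conv_refl. Qed.

(** * Supports *)

(** The existential form of absence from the support, stable under the term constructors. The
    representative may depend on [c]. *)
Definition avoidable (c : nom) (G : list ty) (A : ty) (t : tm G A) : Prop :=
  exists u, conv t u /\ ~ occ (ANom c) u.

Lemma avoidable_in_supp (c : nom) (G : list ty) (A : ty) (t : tm G A) :
  ~ in_supp c t <-> avoidable c t.
Proof.
  split.
  - intros H; apply not_all_ex_not in H; destruct H as [u Hu].
    exists u; apply imply_to_and; assumption.
  - intros [u [Hu Hc]] H; apply Hc, H, Hu.
Qed.

Fixpoint noms (G : list ty) (A : ty) (t : tm G A) : list nom :=
  match t with
  | Var _ => []
  | Nom c => [c]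
  | Kst _ => []
  | Log _ => []
  | App t1 t2 => noms t1 ++ noms t2
  | Lam b => noms b
  end.

Lemma occ_noms (c : nom) (G : list ty) (A : ty) (t : tm G A) :
  occ (ANom c) t -> In c (noms t).
Proof.
  induction t; simpl; try tauto; try discriminate.
  - injection 1; auto.
  - rewrite in_app_iff; tauto.
Qed.

Lemma in_supp_noms (c : nom) (G : list ty) (A : ty) (t : tm G A) :
  in_supp c t -> In c (noms t).
Proof. intros H; apply occ_noms, H, conv_refl. Qed.

(** If [c] is outside the support, the two instances of a representative without [c] are the same
    term; otherwise the two images of [c] are convertible by hypothesis. *)
Lemma hsubst_change_nom (G G' : list ty) (A : ty) (t : tm G A) (s : sub G G')
    (n n' : nsub G') (c : nom) :
  (forall d, d <> c -> n d = n' d) -> (in_supp c t -> conv (n c) (n' c)) ->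
  conv (hsubst s n t) (hsubst s n' t).
Proof.
  intros Hd Hc; destruct (classic (in_supp c t)) as [H | H].
  - apply hsubst_conv_pointwise; [intros; apply conv_refl |].
    intros d; destruct (nom_dec d c) as [-> | e]; [auto |].
    rewrite Hd by assumption; apply conv_refl.
  - apply avoidable_in_supp in H; destruct H as [u [Hu Ho]].
    apply conv_trans with (hsubst s n u); [apply conv_hsubst; assumption |].
    rewrite (@hsubst_ext_occ G G' A u s s n n'); auto.
    + apply conv_hsubst, conv_sym; assumption.
    + intros d Hocc; apply Hd; intros ->; contradiction.
Qed.

(* The nominal constants occurring in a representative but not in the support
   are changed one at a time. *)
Lemma hsubst_agree (G G' : list ty) (A : ty) (t : tm G A) (s : sub G G')
    (n n' : nsub G') :
  (forall c, in_supp c t -> conv (n c) (n' c)) ->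
  conv (hsubst s n t) (hsubst s n' t).
Proof.
  intros Hsupp.
  assert (HL : forall L (m : nsub G'), (forall c, in_supp c t -> conv (m c) (n' c)) ->
    (forall c, ~ In c L -> m c = n' c) -> conv (hsubst s m t) (hsubst s n' t)).
  { induction L as [| c L IH]; intros m Hm HL.
    - rewrite (@hsubst_ext G G' A t s s m n'); auto using conv_refl.
    - set (m' := fun d => if nom_dec c d then n' d else m d).
      apply conv_trans with (hsubst s m' t).
      + apply hsubst_change_nom with c; unfold m'.
        * intros d Hd; destruct (nom_dec c d); congruence.
        * intros H; destruct (nom_dec c c); auto using conv_refl.
      + apply IH; unfold m'; intros d Hd.
        * destruct (nom_dec c d); auto using conv_refl.
        * destruct (nom_dec c d); auto; apply HL; simpl; tauto. }
  (* [m] follows [n] on the constants written in [t] and [n'] elsewhere: it gives the same instance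
     of [t] as [n], and differs from [n'] on a finite list at most. *)
  set (m := fun d => if in_dec (@nom_dec Sg) d (noms t) then n d else n' d).
  rewrite (@hsubst_ext_occ G G' A t s s n m); auto.
  - apply HL with (noms t); unfold m.
    + intros c Hc; destruct (in_dec _ c (noms t)); auto using conv_refl.
    + intros c Hc; destruct (in_dec _ c (noms t)); tauto.
  - intros c Hc; unfold m; apply occ_noms in Hc.
    destruct (in_dec _ c (noms t)); tauto.
Qed.

Lemma avoidable_conv (c : nom) (G : list ty) (A : ty) (t u : tm G A) :
  conv t u -> avoidable c u -> avoidable c t.
Proof. intros H [v [Hv Ho]]; exists v; split; auto; eapply conv_trans; eauto. Qed.

Lemma avoidable_app (c : nom) (G : list ty) (A B : ty) (t : tm G (A ⇒ B)) (u : tm G A) :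
  avoidable c t -> avoidable c u -> avoidable c (App t u).
Proof.
  intros [t' [Ht Ot]] [u' [Hu Ou]]; exists (App t' u'); simpl.
  split; [apply conv_app; auto | tauto].
Qed.

Lemma avoidable_lam (c : nom) (G : list ty) (A B : ty) (b : tm (A :: G) B) :
  avoidable c b -> avoidable c (Lam b).
Proof. intros [b' [H O]]; exists (Lam b'); split; [apply conv_lam |]; auto. Qed.

Lemma avoidable_var (c : nom) (G : list ty) (A : ty) (v : mem G A) :
  avoidable c (@Var Sg G A v).
Proof. exists (Var v); split; [apply conv_refl | simpl; tauto]. Qed.

Lemma avoidable_kst (c : nom) (G : list ty) (k : kst) : avoidable c (@Kst Sg G k).
Proof. exists (Kst k); split; [apply conv_refl | simpl; discriminate]. Qed.

Lemma avoidable_log (c : nom) (G : list ty) (A : ty) (l : lcon A) :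
  avoidable c (@Log Sg G A l).
Proof. exists (Log l); split; [apply conv_refl | simpl; tauto]. Qed.

Lemma avoidable_hsubst_occ (c : nom) (G : list ty) (A : ty) (t : tm G A) :
  forall (G' : list ty) (s : sub G G') (n : nsub G'),
  (forall A v, avoidable c (s A v)) ->
  (forall d, occ (ANom d) t -> avoidable c (n d)) -> avoidable c (hsubst s n t).
Proof.
  assert (Hwk : forall (G G' : list ty) A (u : tm G A) (r : ren G G'),
    ~ occ (ANom c) u -> ~ occ (ANom c) (rename r u)).
  { intros G1 G2 B u; revert G2; induction u; simpl; intros G2 r; auto.
    intros H [O | O]; [eapply IHu1 | eapply IHu2]; eauto. }
  assert (Hav : forall (G G' : list ty) A (u : tm G A) (r : ren G G'),
    avoidable c u -> avoidable c (rename r u)).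
  { intros G1 G2 B u r [u' [Hu Ho]]; exists (rename r u').
    split; [apply conv_rename |]; auto. }
  induction t; intros G' s n Hs Hn; simpl in *; auto.
  - apply avoidable_kst.
  - apply avoidable_log.
  - apply avoidable_app; auto.
  - apply avoidable_lam, IHt; [| intros; apply Hav; auto].
    apply mem_case; [apply avoidable_var |]; intros; apply Hav; auto.
Qed.

Lemma avoidable_subst (c : nom) (G G' : list ty) (A : ty) (t : tm G A) (s : sub G G') :
  avoidable c t -> (forall A v, avoidable c (s A v)) -> avoidable c (subst s t).
Proof.
  intros [u [Hu Ho]] Hs; apply avoidable_conv with (subst s u).
  - apply conv_subst; assumption.
  - rewrite subst_hsubst; apply avoidable_hsubst_occ; auto.
    intros d Hd; exists (Nom d); split; [apply conv_refl |].
    simpl; congruence.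
Qed.

Lemma avoidable_rename (c : nom) (G G' : list ty) (A : ty) (t : tm G A) (r : ren G G') :
  avoidable c t -> avoidable c (rename r t).
Proof.
  intros H; rewrite rename_hsubst, <- subst_hsubst.
  apply avoidable_subst; auto using avoidable_var.
Qed.

Lemma avoidable_wk0 (c : nom) (G : list ty) (A : ty) (t : tm [] A) :
  no_nom t -> avoidable c (wk0 G t).
Proof. intros H; apply avoidable_rename, avoidable_in_supp, H. Qed.

Lemma no_nom_avoidable (G : list ty) (A : ty) (t : tm G A) :
  no_nom t <-> forall c, avoidable c t.
Proof. split; intros H c; apply avoidable_in_supp, H. Qed.

Lemma no_nom_hsubst (G G' : list ty) (A : ty) (t : tm G A) (s : sub G G') (n : nsub G') :
  no_nom t -> conv (hsubst s n t) (subst s t).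
Proof.
  intros H; rewrite subst_hsubst; apply hsubst_agree; intros c Hc; destruct (H c Hc).
Qed.

Lemma no_nom_permute (pi : perm) (G : list ty) (A : ty) (t : tm G A) :
  no_nom t -> conv (permute pi t) t.
Proof.
  intros H; rewrite permute_hsubst.
  eapply conv_trans; [apply no_nom_hsubst; assumption |].
  rewrite subst_hsubst; change (fun c : nom => @Nom Sg G c) with (@Noms G).
  rewrite hsubst_id; apply conv_refl.
Qed.

(** * Injectivity of constants, by normalization by evaluation *)

(* Raw normal forms; [RVar] counts binders from the outside, so that raw terms
   need no weakening.  [RCon] covers constants of all kinds. *)
Inductive raw : Type :=
| RVar (k : nat)
| RCon (A : ty) (t : @tm Sg [] A)
| RApp (A : ty) (r1 r2 : raw)
| RLam (r : raw).

(** A de Bruijn level: it does not change when inner binders are added. *)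
Fixpoint lev (G : list ty) (A : ty) (v : mem G A) : nat :=
  match v with
  | MZ G _ => length G
  | MS _ w => lev w
  end.

(* [rep r t]: r is the eta-long normal form of t. *)
Fixpoint rep (r : raw) : forall (G : list ty) (A : ty), @tm Sg G A -> Prop :=
  match r with
  | RVar k => fun G A t => exists v : mem G A, lev v = k /\ conv t (Var v)
  | RCon t0 => fun G A t => exists e, conv t (eq_rect _ (@tm Sg G) (wk0 G t0) A e)
  | @RApp A0 r1 r2 => fun G A t =>
      exists (t1 : tm G (A0 ⇒ A)) (t2 : tm G A0),
        rep r1 t1 /\ rep r2 t2 /\ conv t (App t1 t2)
  | RLam r1 => fun G A =>
      match A return tm G A -> Prop with
      | TArr A1 A2 => fun t => rep r1 (App (wk A1 t) (Var (MZ G A1)))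
      | _ => fun _ => False
      end
  end.

Lemma rep_conv (r : raw) : forall (G : list ty) (A : ty) (t u : tm G A),
  conv t u -> rep r t -> rep r u.
Proof.
  induction r; intros G A0 u u' H; simpl.
  - intros [v [Hv Hc]]; exists v; split; auto.
    eapply conv_trans; [apply conv_sym |]; eauto.
  - intros [e He]; exists e; eapply conv_trans; [apply conv_sym |]; eauto.
  - intros [t1 [t2 [H1 [H2 Hc]]]]; exists t1, t2; repeat split; auto.
    eapply conv_trans; [apply conv_sym |]; eauto.
  - destruct A0; auto; apply IHr, conv_app; [apply conv_rename | apply conv_refl]; auto.
Qed.

Lemma ty_dec (A B : ty) : {A = B} + {A <> B}.
Proof. decide equality; apply sort_dec. Qed.

Lemma lev_lt (G : list ty) (A : ty) (v : mem G A) : lev v < length G.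
Proof. induction v; simpl; lia. Qed.

Lemma lev_inj (G : list ty) (A : ty) (v w : mem G A) : lev v = lev w -> v = w.
Proof.
  revert A v w; induction G as [| B G IH]; intros A v w.
  { inversion v. }
  assert (Hinv : forall A (v : mem (B :: G) A),
    (exists e : B = A, v = eq_rect B (mem (B :: G)) (MZ G B) A e) \/
    exists w : mem G A, v = MS B w).
  { apply mem_case; [left; exists eq_refl | right; exists w0]; reflexivity. }
  destruct (Hinv A v) as [[e ->] | [v' ->]], (Hinv A w) as [[e' ->] | [w' ->]]; simpl.
  - intros _; f_equal; apply UIP_dec, ty_dec.
  - destruct e; simpl; intros H; pose proof (lev_lt w'); lia.
  - destruct e'; simpl; intros H; pose proof (lev_lt v'); lia.
  - intros H; f_equal; auto.
Qed.

Lemma conv_fun_ext (G : list ty) (A B : ty) (t u : tm G (A ⇒ B)) :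
  conv (App (wk A t) (Var (MZ G A))) (App (wk A u) (Var (MZ G A))) -> conv t u.
Proof.
  intros H; eapply conv_trans; [apply conv_sym, conv_eta |].
  eapply conv_trans; [apply conv_lam, H | apply conv_eta].
Qed.

(** Under [RLam] both terms agree on a fresh variable and eta concludes; for constants the two type
    equations coincide because types have decidable equality. *)
Lemma rep_unique (r : raw) : forall (G : list ty) (A : ty) (t u : tm G A),
  rep r t -> rep r u -> conv t u.
Proof.
  induction r; intros G A0 u u'; simpl.
  - intros [v [<- Hv]] [w [Hl Hw]]; apply lev_inj in Hl; subst.
    eapply conv_trans; [| apply conv_sym]; eauto.
  - intros [e He] [e' He']; rewrite (UIP_dec ty_dec e' e) in He'.
    eapply conv_trans; [| apply conv_sym]; eauto.
  - intros [t1 [t2 [H1 [H2 Hc]]]] [t1' [t2' [H1' [H2' Hc']]]].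
    eapply conv_trans; [exact Hc |].
    eapply conv_trans; [| apply conv_sym; exact Hc'].
    apply conv_app; eauto.
  - destruct A0; try tauto; intros H H'; apply conv_fun_ext; eauto.
Qed.

(** * Evaluation in a model built on raw normal forms *)

Fixpoint sem (A : ty) : Type :=
  match A with
  | TArr A1 A2 => sem A1 -> sem A2
  | _ => nat -> raw
  end.

(* The argument in nat is the number of binders above the position where the
   normal form is placed. *)
Fixpoint reify_reflect (A : ty) : (sem A -> nat -> raw) * ((nat -> raw) -> sem A) :=
  match A return (sem A -> nat -> raw) * ((nat -> raw) -> sem A) with
  | TArr A1 A2 =>
      (fun f k => RLam (fst (reify_reflect A2)
         (f (snd (reify_reflect A1) (fun _ => RVar k))) (S k)),
       fun r a => snd (reify_reflect A2)
         (fun k => RApp A1 (r k) (fst (reify_reflect A1) a k)))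
  | _ => (fun r => r, fun r => r)
  end.

Definition reify (A : ty) : sem A -> nat -> raw := fst (reify_reflect A).
Definition reflect (A : ty) : (nat -> raw) -> sem A := snd (reify_reflect A).

Definition env (G : list ty) := forall A, mem G A -> sem A.

Definition econs (G : list ty) (B : ty) (a : sem B) (E : env G) : env (B :: G) :=
  fun A v =>
    match v in mem H A0
      return match H with
             | [] => unit
             | B0 :: H0 => sem B0 -> env H0 -> sem A0
             end with
    | MZ _ _ => fun a' _ => a'
    | MS _ w => fun _ E' => E' _ w
    end a E.

Definition con_sem (A : ty) (t : @tm Sg [] A) : sem A := reflect A (fun _ => RCon t).

Fixpoint eval (G : list ty) (A : ty) (t : @tm Sg G A) : env G -> sem A :=
  match t in tm _ A0 return env G -> sem A0 with
  | Var v => fun E => E _ v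
  | Nom c => fun _ => con_sem (Nom c)
  | Kst k => fun _ => con_sem (Kst k)
  | Log l => fun _ => con_sem (Log l)
  | App t1 t2 => fun E => eval t1 E (eval t2 E)
  | Lam b => fun E a => eval b (econs a E)
  end.

Lemma env_ext (G : list ty) (E E' : env G) : (forall A v, E A v = E' A v) -> E = E'.
Proof.
  intros H; extensionality A; extensionality v; apply H.
Qed.

Lemma eval_rename (G : list ty) (A : ty) (t : tm G A) :
  forall (G' : list ty) (r : ren G G') (E : env G'),
  eval (rename r t) E = eval t (fun A v => E A (r A v)).
Proof.
  induction t; intros G' r E; simpl; auto.
  - rewrite IHt1, IHt2; reflexivity.
  - extensionality a; rewrite IHt; f_equal; apply env_ext.
    apply mem_case; reflexivity.
Qed.

Lemma eval_subst (G : list ty) (A : ty) (t : tm G A) :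
  forall (G' : list ty) (s : sub G G') (E : env G'),
  eval (subst s t) E = eval t (fun A v => eval (s A v) E).
Proof.
  induction t; intros G' s E; simpl; auto.
  - rewrite IHt1, IHt2; reflexivity.
  - extensionality a; rewrite IHt; f_equal; apply env_ext.
    apply mem_case; [reflexivity |]; intros; simpl.
    unfold wk; rewrite eval_rename; reflexivity.
Qed.

(** Beta is the substitution lemma; eta and congruence under [Lam] hold by extensionality, arrow
    types being full function spaces. *)
Lemma eval_conv (G : list ty) (A : ty) (t u : tm G A) :
  conv t u -> forall E, eval t E = eval u E.
Proof.
  induction 1; intros E; simpl; try congruence.
  - extensionality a; auto.
  - unfold inst; rewrite eval_subst; f_equal; apply env_ext.
    apply mem_case; reflexivity.
  - extensionality a; unfold wk; rewrite eval_rename; reflexivity.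
Qed.

(** * A Kripke logical relation between terms and values *)

Inductive wkn (G : list ty) : list ty -> Type :=
| wkn_refl : wkn G G
| wkn_cons (G' : list ty) (B : ty) : wkn G G' -> wkn G (B :: G').

Fixpoint wkn_ren (G G' : list ty) (w : wkn G G') : ren G G' :=
  match w in wkn _ G0 return ren G G0 with
  | wkn_refl _ => fun A v => v
  | wkn_cons B w' => fun A v => MS B (wkn_ren w' v)
  end.

Fixpoint wkn_trans (G G' G'' : list ty) (w : wkn G G') (w' : wkn G' G'') : wkn G G'' :=
  match w' in wkn _ G0 return wkn G G0 with
  | wkn_refl _ => w
  | wkn_cons B w2 => wkn_cons B (wkn_trans w w2)
  end.

Lemma rename_wkn_trans (G G' G'' : list ty) (w : wkn G G') (w' : wkn G' G'') (A : ty)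
    (t : @tm Sg G A) :
  rename (wkn_ren w') (rename (wkn_ren w) t) = rename (wkn_ren (wkn_trans w w')) t.
Proof.
  rewrite rename_rename, !rename_hsubst; apply hsubst_ext; [| reflexivity].
  intros B v; f_equal; induction w'; simpl; congruence.
Qed.

Lemma rename_wkn_refl (G : list ty) (A : ty) (t : @tm Sg G A) :
  rename (wkn_ren (wkn_refl G)) t = t.
Proof. rewrite rename_hsubst; apply hsubst_id_ext; reflexivity. Qed.

(** This is why the worlds of [val] only add inner variables: an arbitrary renaming could change
    levels, and with them the raw forms. *)
Lemma lev_wkn (G G' : list ty) (w : wkn G G') (A : ty) (v : mem G A) :
  lev (wkn_ren w v) = lev v.
Proof. induction w; simpl; auto. Qed.

Fixpoint val (A : ty) : forall G : list ty, @tm Sg G A -> sem A -> Prop :=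
  match A return forall G, tm G A -> sem A -> Prop with
  | TArr A1 A2 => fun G t f =>
      forall G' (w : wkn G G') (u : tm G' A1) (a : sem A1),
        val u a -> val (App (rename (wkn_ren w) t) u) (f a)
  | _ => fun G t r => forall G' (w : wkn G G'),
        rep (r (length G')) (rename (wkn_ren w) t)
  end.

Lemma val_conv (A : ty) : forall (G : list ty) (t u : tm G A) (a : sem A),
  conv t u -> val t a -> val u a.
Proof.
  induction A; simpl; intros G t u a H Ht G' w.
  1, 2: apply rep_conv with (rename (wkn_ren w) t); [apply conv_rename |]; auto.
  intros v b Hv; apply IHA2 with (App (rename (wkn_ren w) t) v); auto.
  apply conv_app; [apply conv_rename | apply conv_refl]; auto.
Qed.

Lemma val_wkn (A : ty) (G G' : list ty) (w : wkn G G') (t : tm G A) (a : sem A) :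
  val t a -> val (rename (wkn_ren w) t) a.
Proof.
  destruct A; simpl; intros H G'' w'; intros; rewrite rename_wkn_trans; auto.
Qed.

(** The two halves need each other: at an arrow type, reifying feeds a reflected variable to the
    function, and reflecting reifies the argument. *)
Lemma reify_reflect_val (A : ty) :
  (forall (G : list ty) (t : tm G A) (a : sem A), val t a ->
     forall G' (w : wkn G G'), rep (reify a (length G')) (rename (wkn_ren w) t)) /\
  (forall (G : list ty) (t : tm G A) (r : nat -> raw),
     (forall G' (w : wkn G G'), rep (r (length G')) (rename (wkn_ren w) t)) ->
     val t (reflect A r)).
Proof.
  induction A as [b | | A1 [IHf1 IHr1] A2 [IHf2 IHr2]]; [split; auto .. |].
  split.
  - intros G t f Ht G' w.
    change (rep (reify (f (reflect A1 (fun _ => RVar (length G')))) (length (A1 :: G')))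
              (App (wk A1 (rename (wkn_ren w) t)) (Var (MZ G' A1)))).
    rewrite <- (rename_wkn_refl (App _ _)); apply IHf2.
    unfold wk; rewrite rename_rename.
    apply (Ht _ (wkn_cons A1 w)), IHr1.
    (* The new variable has level [length G'], the number of binders above it, and keeps it in every
       larger context. *)
    intros G'' w'; simpl; exists (wkn_ren w' (MZ G' A1)).
    rewrite lev_wkn; split; [reflexivity | apply conv_refl].
  - intros G t r Hr G' w u a Hu; apply IHr2; intros G'' w'; simpl.
    rewrite rename_wkn_trans.
    do 2 eexists; split; [| split; [| apply conv_refl]]; auto.
    apply IHf1; assumption.
Qed.

Lemma con_sem_val (G : list ty) (A : ty) (t : @tm Sg [] A) :
  val (wk0 G t) (con_sem t).
Proof.
  apply reify_reflect_val; intros G' w; simpl; exists eq_refl; simpl.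
  unfold wk0; rewrite rename_rename, !rename_hsubst.
  apply conv_eq, hsubst_ext; [| reflexivity].
  intros B v; inversion v.
Qed.

(** Fundamental lemma of the relation. At [Lam] the beta-redex is contracted, which is sound because
    [val] respects conversion. *)
Lemma eval_val (G : list ty) (A : ty) (t : tm G A) :
  forall (G' : list ty) (s : sub G G') (E : env G),
  (forall A v, val (s A v) (E A v)) -> val (subst s t) (eval t E).
Proof.
  induction t; intros G' s E H; simpl; auto.
  - apply (@con_sem_val G' _ (Nom c)).
  - apply (@con_sem_val G' _ (Kst k)).
  - apply (@con_sem_val G' _ (Log l)).
  - specialize (IHt1 _ _ _ H); simpl in IHt1.
    rewrite <- (rename_wkn_refl (subst s t1)); auto.
  - intros G'' w u a Hu.
    apply val_conv with (subst (scons u (fun A v => rename (wkn_ren w) (s A v))) t).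
    + apply conv_sym; eapply conv_trans; [apply conv_beta |].
      unfold inst; rewrite !subst_hsubst, rename_hsubst, !hsubst_hsubst.
      apply conv_eq, hsubst_ext; [| reflexivity].
      apply mem_case; [reflexivity |]; intros C v; simpl.
      unfold wk; rewrite !hsubst_rename, rename_hsubst; reflexivity.
    + apply IHt; apply mem_case; [exact Hu |]; intros; simpl; apply val_wkn; auto.
Qed.

Definition id_env (G : list ty) : env G :=
  fun A v => reflect A (fun _ => RVar (lev v)).

Lemma id_env_val (G : list ty) (A : ty) (t : tm G A) : val t (eval t (@id_env G)).
Proof.
  rewrite <- (hsubst_id t) at 1; rewrite <- subst_hsubst; apply eval_val.
  intros B v; apply reify_reflect_val; intros G' w; simpl.
  exists (wkn_ren w v); rewrite lev_wkn; split; [reflexivity | apply conv_refl].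
Qed.

(** Each term is represented by the normal form of its own value, so equal normal forms force
    conversion by [rep_unique]. *)
Lemma reify_eval_conv (G : list ty) (A : ty) (t u : tm G A) :
  reify (eval t (@id_env G)) (length G) = reify (eval u (@id_env G)) (length G) ->
  conv t u.
Proof.
  intros H.
  pose proof (proj1 (reify_reflect_val A) _ _ _ (id_env_val t) _ (wkn_refl G)) as Ht.
  pose proof (proj1 (reify_reflect_val A) _ _ _ (id_env_val u) _ (wkn_refl G)) as Hu.
  rewrite rename_wkn_refl in Ht, Hu; rewrite H in Ht; eapply rep_unique; eauto.
Qed.

(** * Argument lists under a rigid head *)

Inductive tms_conv (G : list ty) : forall As : list ity, tms G As -> tms G As -> Prop :=
| tms_conv_nil : tms_conv (@tnil Sg G) tnil
| tms_conv_cons (a : ity) (As : list ity) (t u : tm G (inj a)) (ts us : tms G As) :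
    conv t u -> tms_conv ts us -> tms_conv (tcons t ts) (tcons u us).

Lemma tms_inv (G : list ty) (As : list ity) (ts : @tms Sg G As) :
  match As return tms G As -> Prop with
  | [] => fun ts => ts = tnil
  | a :: As' => fun ts => exists t ts', ts = tcons t ts'
  end ts.
Proof. destruct ts; [reflexivity | do 2 eexists; reflexivity]. Qed.

(** The heads are generalized to terms with neutral values, a property that application preserves.
    Arguments can then be peeled off one at a time, each leaving its normal form in an [RApp]. *)
Lemma neutral_apps_inj (G : list ty) (k : kst) (As : list ity) :
  forall (us vs : tms G As) (h h' : tm G (arrs As (ktgt k))) (r r' : nat -> raw),
  eval h (@id_env G) = reflect _ r -> eval h' (@id_env G) = reflect _ r' ->
  conv (apps h us) (apps h' vs) -> r = r' /\ tms_conv us vs.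
Proof.
  induction As as [| a As IH]; intros us vs h h' r r' Hh Hh' Hc.
  - rewrite (tms_inv us), (tms_inv vs) in *; simpl in *.
    split; [| constructor]; apply eval_conv with (E := @id_env G) in Hc.
    (* The target is a base type or [TO]; at both, [reflect] is the identity. *)
    destruct k; rewrite Hh, Hh' in Hc; exact Hc.
  - destruct (tms_inv us) as [u [us' ->]], (tms_inv vs) as [v [vs' ->]]; simpl in *.
    destruct (IH us' vs' (App h u) (App h' v)
      (fun k => RApp (inj a) (r k) (reify (eval u (@id_env G)) k))
      (fun k => RApp (inj a) (r' k) (reify (eval v (@id_env G)) k))) as [Hr Hus]; auto.
    + simpl; rewrite Hh; reflexivity.
    + simpl; rewrite Hh'; reflexivity.
    + split.
      (* Comparison at every depth [i] identifies the heads; depth [length G] then gives the normal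
         forms of the first arguments. *)
      * extensionality i; apply (f_equal (fun f => f i)) in Hr; congruence.
      * constructor; auto; apply reify_eval_conv.
        apply (f_equal (fun f => f (length G))) in Hr; congruence.
Qed.

Lemma kst_apps_inj (G : list ty) (k : kst) (us vs : tms G (kargs k)) :
  conv (apps (Kst k) us) (apps (Kst k) vs) -> tms_conv us vs.
Proof.
  intros H; eapply neutral_apps_inj in H; [apply H | reflexivity | reflexivity].
Qed.

(** * Uniqueness of nominal capture avoiding substitution up to permutation *)

Definition swap_fun (a : ity) (m n : nat) (b : ity) (i : nat) : nat :=
  if ity_dec a b then
    if Nat.eq_dec i m then n else if Nat.eq_dec i n then m else i
  else i.

Lemma swap_funK (a : ity) (m n : nat) (b : ity) (i : nat) :
  swap_fun a m n b (swap_fun a m n b i) = i.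
Proof.
  unfold swap_fun; destruct (ity_dec a b); [| reflexivity].
  repeat destruct (Nat.eq_dec _ _); congruence.
Qed.

Definition swap (a : ity) (m n : nat) : perm.
Proof.
  apply (@Perm Sg (swap_fun a m n) (swap_fun a m n)); try apply swap_funK.
  exists [(a, m); (a, n)]; intros b i H; unfold swap_fun; simpl in H.
  destruct (ity_dec a b) as [<- |]; [| reflexivity].
  repeat destruct (Nat.eq_dec _ _); subst; tauto.
Defined.

Definition perm_id : perm.
Proof.
  apply (@Perm Sg (fun _ n => n) (fun _ n => n)); auto; exists []; auto.
Defined.

Definition perm_comp (pi rho : perm) : perm.
Proof.
  apply (@Perm Sg (fun a n => pfun pi a (pfun rho a n))
                  (fun a n => pinv rho a (pinv pi a n))).
  - intros; rewrite !pfunK; reflexivity.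
  - intros; rewrite !pinvK; reflexivity.
  - destruct (pfinite pi) as [L HL], (pfinite rho) as [L' HL']; exists (L ++ L').
    intros a n H; rewrite in_app_iff in H; rewrite HL', HL; tauto.
Defined.

Lemma pfun_inj (pi : perm) (a : ity) (m n : nat) : pfun pi a m = pfun pi a n -> m = n.
Proof. intros H; rewrite <- (pfunK pi a m), H, pfunK; reflexivity. Qed.

(** A finite partial bijection extends to a permutation that moves only points of its domain and
    range. Each new pair is handled by composing with the transposition of [sigma (f a m)] and
    [g a m]; injectivity of [f] and [g] keeps it off the pairs already treated. *)
Lemma perm_extend (f g : ity -> nat -> nat) (L : list nom) :
  (forall a m n, f a m = f a n -> m = n) -> (forall a m n, g a m = g a n -> m = n) ->
  exists sigma : perm,
    (forall a n, In (a, n) L -> pfun sigma a (f a n) = g a n) /\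
    (forall a i, (forall n, In (a, n) L -> i <> f a n /\ i <> g a n) ->
       pfun sigma a i = i).
Proof.
  intros Hf Hg; induction L as [| [a m] L [sg [IH1 IH2]]].
  { exists perm_id; simpl; tauto. }
  destruct (in_dec (@nom_dec Sg) (a, m) L) as [Hin | Hin].
  { exists sg; split.
    - intros b n [[= <- <-] | H]; auto.
    - intros b i H; apply IH2; intros n Hn; apply H; simpl; auto. }
  exists (perm_comp (swap a (pfun sg a (f a m)) (g a m)) sg); split; simpl.
  - intros b n [[= <- <-] | H]; unfold swap_fun.
    + destruct (ity_dec a a); [| congruence].
      destruct (Nat.eq_dec _ _); congruence.
    + destruct (ity_dec a b) as [<- |]; [| auto].
      assert (n <> m) by (intros ->; contradiction).
      destruct (Nat.eq_dec _ _) as [E | _].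
      { apply pfun_inj, Hf in E; contradiction. }
      rewrite IH1 by assumption.
      destruct (Nat.eq_dec _ _) as [E | _]; [apply Hg in E; contradiction | reflexivity].
  - intros b i H; assert (Hi : pfun sg b i = i).
    { apply IH2; intros n Hn; exact (H n (or_intror Hn)). }
    rewrite Hi; unfold swap_fun.
    destruct (ity_dec a b) as [<- |]; [| reflexivity].
    destruct (H m (or_introl eq_refl)) as [H1 H2].
    destruct (Nat.eq_dec _ _) as [E | _].
    { rewrite <- Hi in E; apply pfun_inj in E; contradiction. }
    destruct (Nat.eq_dec _ _); [contradiction | reflexivity].
Qed.

Lemma list_bounded (L : list nom) : exists M, forall c, In c L -> snd c < M.
Proof.
  induction L as [| c L [M HM]]; [exists 0; simpl; tauto |].
  exists (S (snd c) + M); intros d [<- | H]; [lia |]; specialize (HM d H); lia.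
Qed.

(** Contexts are finite, so the indices are bounded; shifting past the bound gives fresh constants
    at every type. *)
Lemma supp_sub_bounded (G G' : list ty) (s : sub G G') :
  exists M, forall c : nom, in_supp_sub c s -> snd c < M.
Proof.
  induction G as [| B G IH].
  - exists 0; intros c [A [v _]]; inversion v.
  - destruct (IH (fun A v => s A (MS B v))) as [M HM].
    destruct (list_bounded (noms (s B (MZ G B)))) as [N HN].
    exists (M + N); intros c [A [v Hv]]; revert A v Hv.
    refine (mem_case _ _); intros.
    + apply in_supp_noms, HN in Hv; lia.
    + assert (snd c < M) by (apply HM; exists A, w; assumption); lia.
Qed.

Lemma ncas_exists (G G' : list ty) (th : sub G G') (A : ty) (t : tm G A) :
  exists u, ncas th t u.
Proof.
  destruct (supp_sub_bounded th) as [M HM].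
  (* Shifting by [M] moves each constant written in [t] beyond the support of [th]. *)
  destruct (@perm_extend (fun _ n => n) (fun _ n => M + n) (noms t)) as [pi [Hpi _]];
    [auto | lia |].
  exists (subst th (permute pi t)), pi; split; [| reflexivity].
  intros [a n] Hc Hs; apply HM in Hs; simpl in Hs.
  rewrite Hpi in Hs by (apply in_supp_noms; assumption); lia.
Qed.

Lemma list_filter_prop (X : Type) (P : X -> Prop) (L : list X) :
  exists L', forall x, In x L' <-> In x L /\ P x.
Proof.
  induction L as [| y L [L' H]]; [exists []; simpl; tauto |].
  destruct (classic (P y)) as [Hy | Hy].
  - exists (y :: L'); intros x; simpl; rewrite H; intuition congruence.
  - exists L'; intros x; simpl; rewrite H; intuition congruence.
Qed.

(* Two admissible permutations of the support are related by a permutation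
   that fixes the support of the substitution. *)
Lemma ncas_eqvt (G G' : list ty) (th : sub G G') (A : ty) (t : tm G A)
    (u u' : tm G' A) :
  ncas th t u -> ncas th t u' -> eqvt u u'.
Proof.
  intros [pi [Hpi ->]] [pi' [Hpi' ->]].
  destruct (list_filter_prop (fun c => in_supp c t) (noms t)) as [L HL].
  destruct (@perm_extend (pfun pi') (pfun pi) L) as [sg [H1 H2]]; try apply pfun_inj.
  exists sg; apply conv_sym; to_hsubst; simpl.
  apply conv_trans with (hsubst th (fun c => @Nom Sg G' (pact sg (pact pi' c))) t).
  - apply hsubst_conv_pointwise; [| intros; apply conv_refl].
    intros B v; unfold Vars; simpl.
    eapply conv_trans; [| apply conv_eq, hsubst_id].
    apply hsubst_agree; intros [a i] Hc.
    apply conv_eq; unfold Noms, pact; simpl.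
    rewrite H2; [reflexivity |]; intros n Hn; apply HL in Hn; destruct Hn as [_ Hn].
    split; intros ->; [apply (Hpi' _ Hn) | apply (Hpi _ Hn)]; exists B, v; exact Hc.
  - apply hsubst_agree; intros [a n] Hc; apply conv_eq; unfold Noms, pact; simpl.
    rewrite H1; [reflexivity |]; apply HL; split; auto using in_supp_noms.
Qed.

(** * Weakening of derivations by eigenvariables *)

Lemma Forall2_refl (X : Type) (R : X -> X -> Prop) (L : list X) :
  (forall x, R x x) -> Forall2 R L L.
Proof. intros H; induction L; auto. Qed.

Lemma der_conv (D : gdef Sg) (G : list ty) (Gm : list (form G)) (B B' C C' : form G) :
  conv B B' -> conv C C' -> der D (B :: Gm) C -> der D (B' :: Gm) C'.
Proof.
  intros HB HC; apply d_eq with (B :: Gm); auto.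
  constructor; auto; apply Forall2_refl; intros; apply conv_refl.
Qed.

Lemma der_perm (D : gdef Sg) (G : list ty) (Gm Gm' : list (form G)) (C : form G) :
  Permutation Gm Gm' -> der D Gm C -> der D Gm' C.
Proof.
  intros HP; apply d_eq with Gm'; auto using conv_refl.
  apply Forall2_refl; intros; apply conv_refl.
Qed.

(** Each formula is exchanged by a cut against an identity axiom, so different formulas may use
    different permutations. *)
Lemma der_eqvt (D : gdef Sg) (G : list ty) (Gm Gm' : list (form G)) (C C' : form G) :
  Forall2 (fun B B' => eqvt B B') Gm' Gm -> eqvt C C' -> der D Gm C -> der D Gm' C'.
Proof.
  intros HG HC H.
  assert (HC' : der D Gm C').
  { rewrite <- (app_nil_r Gm); apply d_cut with C; auto; apply d_id; auto. }
  clear H; rewrite <- (app_nil_r Gm) in HC'; rewrite <- (app_nil_r Gm').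
  (* [Dl] accumulates the hypotheses already exchanged. *)
  revert HC'; generalize (@nil (form G)) as Dl.
  induction HG as [| B' B Gm' Gm HB HG IH]; intros Dl HC'; auto.
  apply der_perm with (Gm' ++ B' :: Dl).
  { apply Permutation_sym, Permutation_middle. }
  apply IH; apply der_perm with ([B'] ++ (Gm ++ Dl)).
  { exact (Permutation_middle Gm Dl B'). }
  apply d_cut with B; auto; apply d_id; auto.
Qed.

(** What makes a renaming preserve supports exactly: if [c] can be avoided in [rename r t], applying
    [s] shows that it can be avoided in [t]. The retraction depends on [c] because nominal constants
    may have to serve as values of the new variables. *)
Definition retractable (G G' : list ty) (r : ren G G') : Prop :=
  forall c : nom, exists s : sub G' G,
    (forall A v, s A (r A v) = Var v) /\ (forall A v, avoidable c (s A v)).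

Lemma retractable_up (G G' : list ty) (B : ty) (r : ren G G') :
  retractable r -> retractable (ren_up (B := B) r).
Proof.
  intros H c; destruct (H c) as [s [Hr Ho]]; exists (sub_up s); split.
  - apply mem_case; [reflexivity |]; intros A w; simpl; rewrite Hr; reflexivity.
  - apply mem_case; [apply avoidable_var |]; intros; apply avoidable_rename, Ho.
Qed.

Lemma in_supp_rename (c : nom) (G G' : list ty) (r : ren G G') (A : ty) (t : tm G A) :
  retractable r -> in_supp c (rename r t) <-> in_supp c t.
Proof.
  intros H; split; intros Hc; apply NNPP; intros Hn; apply avoidable_in_supp in Hn.
  - apply avoidable_rename with (r := r) in Hn.
    apply avoidable_in_supp in Hn; contradiction.
  - destruct (H c) as [s [Hr Ho]].
    apply avoidable_subst with (s := s) in Hn; auto.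
    apply avoidable_in_supp in Hn; apply Hn; clear Hn.
    rewrite subst_hsubst, hsubst_rename, hsubst_id_ext; auto.
Qed.

Lemma lists_supp_rename (cs : list nom) (G G' : list ty) (r : ren G G') (A : ty)
    (t : tm G A) :
  retractable r -> lists_supp cs t -> lists_supp cs (rename r t).
Proof.
  intros H [Hd Hc]; split; auto; intros c; rewrite Hc, in_supp_rename; tauto.
Qed.

Lemma rename_apps (G G' : list ty) (r : ren G G') (As : list ity) (A : ty)
    (t : tm G (arrs As A)) (ts : tms G As) :
  rename r (apps t ts) = apps (rename r t) (tms_map (fun A => @rename Sg G G' A r) ts).
Proof. induction ts; simpl; auto; rewrite IHts; reflexivity. Qed.

Lemma rename_wk0 (G G' : list ty) (r : ren G G') (A : ty) (t : @tm Sg [] A) :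
  rename r (wk0 G t) = wk0 G' t.
Proof.
  unfold wk0; rewrite rename_rename, !rename_hsubst; apply hsubst_ext; [| reflexivity].
  intros B v; inversion v.
Qed.

Lemma rename_inst (G G' : list ty) (r : ren G G') (A B : ty) (b : tm (A :: G) B)
    (u : tm G A) :
  rename r (inst b u) = inst (rename (ren_up r) b) (rename r u).
Proof.
  to_hsubst; apply hsubst_ext; [| reflexivity].
  apply mem_case; reflexivity.
Qed.

Lemma rename_app_noms (G G' : list ty) (r : ren G G') (cs : list nom) (a : ity) :
  forall t : tm G (inj (iarrs (map fst cs) a)),
  rename r (app_noms t) = app_noms (rename r t).
Proof. induction cs as [| c cs IH]; intros t; simpl; auto; rewrite IH; reflexivity. Qed.

Lemma rename_raise (G G' : list ty) (r : ren G G') (cs : list nom) (a : ity)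
    (B : form (inj a :: G)) :
  rename (ren_up r) (raise cs B) = raise cs (rename (ren_up r) B).
Proof.
  unfold raise; to_hsubst; apply hsubst_ext; [| reflexivity].
  apply mem_case; simpl; [| reflexivity].
  rewrite <- rename_hsubst, rename_app_noms; reflexivity.
Qed.

Lemma subst_permute_rename (G G' G'' : list ty) (r : ren G G') (th : sub G' G'')
    (pi : perm) (A : ty) (t : tm G A) :
  subst th (permute pi (rename r t)) =
  subst (fun A v => th A (r A v)) (permute pi t).
Proof. to_hsubst; reflexivity. Qed.

Lemma avoids_rename (G G' G'' : list ty) (r : ren G G') (th : sub G' G'')
    (pi : perm) (A : ty) (t : tm G A) :
  retractable r -> avoids pi th (rename r t) ->
  avoids pi (fun A v => th A (r A v)) t.
Proof.
  intros Hr H c Hc [B [v Hv]]; apply (H c).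
  - apply in_supp_rename; auto.
  - exists B, (r B v); exact Hv.
Qed.

Lemma ncas_rename (G G' G'' : list ty) (r : ren G G') (th : sub G' G'') (A : ty)
    (t : tm G A) (u : tm G'' A) :
  retractable r -> ncas th (rename r t) u -> ncas (fun A v => th A (r A v)) t u.
Proof.
  intros Hr [pi [Hpi ->]]; exists pi; split; [apply avoids_rename; auto |].
  apply subst_permute_rename.
Qed.

Lemma solution_rename (G G' G'' : list ty) (r : ren G G') (th : sub G' G'')
    (As : list ity) (A : ty) (s : tm G (arrs As A)) (t : tm G A) :
  retractable r -> solution th (rename r s) (rename r t) ->
  solution (fun A v => th A (r A v)) s t.
Proof.
  intros Hr [pi [Hpi H]]; exists pi; split.
  - apply avoids_rename; auto.
  - rewrite !subst_permute_rename in H; exact H.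
Qed.

Lemma Forall2_ncas_eqvt (G G' : list ty) (th : sub G G') (A : ty)
    (ts : list (tm G A)) (us us' : list (tm G' A)) :
  Forall2 (fun B B' => ncas th B B') ts us ->
  Forall2 (fun B B' => ncas th B B') ts us' -> Forall2 (fun B B' => eqvt B B') us us'.
Proof.
  intros H; revert us'; induction H; intros us' H'; inversion H'; subst; constructor; auto.
  eapply ncas_eqvt; eauto.
Qed.

Lemma Forall2_ncas_rename (G G' G'' : list ty) (r : ren G G') (th : sub G' G'')
    (A : ty) (ts : list (tm G A)) (us : list (tm G'' A)) :
  retractable r -> Forall2 (fun B B' => ncas th B B') (map (rename r) ts) us ->
  Forall2 (fun B B' => ncas (fun A v => th A (r A v)) B B') ts us.
Proof.
  intros Hr; revert us; induction ts as [| t ts IH]; intros us H; inversion H; subst;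
    constructor; auto using ncas_rename.
Qed.

Lemma map_rename_wk (G G' : list ty) (r : ren G G') (B : ty) (Gm : list (form G)) :
  map (rename (ren_up r)) (map (fun F => wk B F) Gm) =
  map (fun F => wk B F) (map (rename r) Gm).
Proof. rewrite !map_map; apply map_ext; intros; apply rename_wk. Qed.

(** Supports being invariant, the side conditions carry over and raising uses the same constants.
    The induction and co-induction premises about the invariant live in their own context and are
    reused unchanged. *)
Lemma der_rename (D : gdef Sg) (G : list ty) (Gm : list (form G)) (C : form G) :
  der D Gm C -> forall (G' : list ty) (r : ren G G'), retractable r ->
  der D (map (rename r) Gm) (rename r C).
Proof.
  induction 1; intros G0 r Hr; simpl.
  - apply d_eq with (map (rename r) Gm) (map (rename r) Gm1) (rename r C); auto.
    + apply Permutation_map; assumption.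
    + clear - H0; induction H0; simpl; constructor; auto; apply conv_rename; auto.
    + apply conv_rename; assumption.
  - apply d_id; destruct H as [pi H]; exists pi.
    replace (permute pi (rename r B')) with (rename r (permute pi B')).
    + apply conv_rename; assumption.
    + to_hsubst; reflexivity.
  - rewrite map_app; eapply d_cut; [apply IHder1 | apply IHder2]; auto.
  - apply d_cL; apply IHder; auto.
  - apply d_botL.
  - apply d_topR.
  - apply d_orL; [apply IHder1 | apply IHder2]; auto.
  - apply d_orR1; apply IHder; auto.
  - apply d_orR2; apply IHder; auto.
  - apply d_andL1; apply IHder; auto.
  - apply d_andL2; apply IHder; auto.
  - apply d_andR; [apply IHder1 | apply IHder2]; auto.
  - apply d_impL; [apply IHder1 | apply IHder2]; auto.
  - apply d_impR; apply IHder; auto.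
  - apply d_allL with (rename r t); rewrite <- rename_inst; apply IHder; auto.
  - apply d_exR with (rename r t); rewrite <- rename_inst; apply IHder; auto.
  - apply d_allR with cs; [apply lists_supp_rename; auto using retractable_up |].
    rewrite <- map_rename_wk, <- rename_raise; apply IHder; auto using retractable_up.
  - apply d_exL with cs; [apply lists_supp_rename; auto using retractable_up |].
    rewrite <- map_rename_wk, <- rename_raise, <- rename_wk.
    apply IHder; auto using retractable_up.
  - apply (@d_nablaL Sg D _ _ c (rename (ren_up r) B)).
    + rewrite in_supp_rename; auto using retractable_up.
    + change (@Nom Sg G0 c) with (rename r (Nom c)).
      rewrite <- rename_inst; apply IHder; auto.
  - apply (@d_nablaR Sg D _ _ c (rename (ren_up r) B)).
    + rewrite in_supp_rename; auto using retractable_up.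
    + change (@Nom Sg G0 c) with (rename r (Nom c)).
      rewrite <- rename_inst; apply IHder; auto.
  (* Values of the weakened sequent under every [th] are chosen arbitrarily, as functions of
     [th]. *)
  - assert (HG : forall G' (th : sub G0 G'), exists Gm',
      Forall2 (fun B B' => ncas th B B') (map (rename r) Gm) Gm').
    { intros G' th; induction (map (rename r) Gm) as [| B Bs [Bs' IH]].
      - exists []; constructor.
      - destruct (ncas_exists th B) as [B' HB]; exists (B' :: Bs'); auto. }
    set (Gs' := fun G' th =>
      proj1_sig (constructive_indefinite_description _ (HG G' th))).
    set (Cs' := fun G' th =>
      proj1_sig (constructive_indefinite_description _
        (@ncas_exists _ G' th _ (rename r C)))).
    assert (HGs : forall G' th,
      Forall2 (fun B B' => ncas th B B') (map (rename r) Gm) (Gs' G' th)).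
    { intros G' th; unfold Gs'; destruct (constructive_indefinite_description _ _); auto. }
    assert (HCs : forall G' th, ncas th (rename r C) (Cs' G' th)).
    { intros G' th; unfold Cs'; destruct (constructive_indefinite_description _ _); auto. }
    apply d_nabsL with Gs' Cs'; auto.
    intros G' th HE Hsol; apply solution_rename in Hsol; auto.
    (* The original premise at [th] composed with [r] proves the required sequent up to permutations
       of its formulas. *)
    eapply der_eqvt; [| | apply (H1 G' _ HE Hsol)].
    + eapply Forall2_ncas_eqvt; [| apply H; auto].
      apply Forall2_ncas_rename; auto.
    + eapply ncas_eqvt; [apply H0; auto |]; apply ncas_rename; auto.
  - apply d_nabsR; destruct H as [cs [e [Hd Hc]]]; exists cs, e; split; auto.
    destruct e; simpl in *.
    replace (lam_noms cs (rename r t)) with (rename r (lam_noms cs t)).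
    + apply conv_rename; assumption.
    + clear; induction cs as [| c cs IH]; simpl; auto.
      rewrite <- IH; unfold lam_nom; simpl; f_equal; to_hsubst; apply hsubst_ext; auto.
      intros d; simpl; unfold repl_nsub.
      destruct (nom_dec c d) as [e |]; [destruct e |]; reflexivity.
  - rewrite rename_apps; eapply d_defL; eauto.
    specialize (IHder _ r Hr); simpl in IHder; rewrite rename_apps in IHder.
    simpl in IHder; rewrite rename_wk0 in IHder; exact IHder.
  - rewrite rename_apps; eapply d_defR; eauto.
    specialize (IHder _ r Hr); simpl in IHder; rewrite rename_apps in IHder.
    simpl in IHder; rewrite rename_wk0 in IHder; exact IHder.
  - rewrite rename_apps; eapply d_IL; eauto.
    specialize (IHder2 _ r Hr); simpl in IHder2; rewrite rename_apps in IHder2.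
    rewrite rename_wk0 in IHder2; exact IHder2.
  - rewrite rename_apps; eapply d_CIR; eauto.
    specialize (IHder1 _ r Hr); rewrite rename_apps in IHder1.
    rewrite rename_wk0 in IHder1; exact IHder1.
Qed.

(** Eigenvariable types are o-free, hence inhabited by nominal constants. *)
Lemma retractable_ren_nil (G : list ty) : eigen G -> retractable (@ren_nil Sg G).
Proof.
  intros HE c.
  assert (Hs : exists s : sub G [], forall A v, avoidable c (s A v)).
  { induction HE as [| A G [a ->] HE [s Hs]].
    - exists (fun A (v : mem [] A) => Var v); intros; apply avoidable_var.
    (* The successor index makes this constant differ from [c] whatever its type. *)
    - exists (scons (@Nom Sg [] (a, S (snd c))) s).
      apply mem_case; [| exact Hs].
      exists (@Nom Sg [] (a, S (snd c))); split; [apply conv_refl |]; simpl.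
      intros [= E]; subst; apply (f_equal snd) in E; simpl in E; lia. }
  destruct Hs as [s Hs]; exists s; split; auto; intros A v; inversion v.
Qed.

(** * Telescopes of binders *)

Fixpoint sub_ups (As : list ity) :
    forall G G' : list ty, @sub Sg G G' -> sub (ext As G) (ext As G') :=
  match As return forall G G', sub G G' -> sub (ext As G) (ext As G') with
  | [] => fun G G' s => s
  | a :: As' => fun G G' s => @sub_ups As' _ _ (sub_up (B := inj a) s)
  end.
Arguments sub_ups As {G G'} s [A] _.

Fixpoint sub_tms (As : list ity) (G' : list ty) (us : tms G' As) :
    forall G : list ty, @sub Sg G G' -> sub (ext As G) G' :=
  match us in tms _ As0 return forall G, sub G G' -> sub (ext As0 G) G' with
  | tnil => fun G s => s
  | tcons u us' => fun G s => sub_tms us' (scons u s)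
  end.

Fixpoint Alls (As : list ity) : forall G : list ty, form (ext As G) -> form G :=
  match As return forall G, form (ext As G) -> form G with
  | [] => fun G B => B
  | a :: As' => fun G B => All (a := a) (Alls (G := inj a :: G) B)
  end.

Lemma subst_ext (G G' : list ty) (A : ty) (t : tm G A) (s s' : sub G G') :
  (forall A v, s A v = s' A v) -> subst s t = subst s' t.
Proof. intros H; rewrite !subst_hsubst; apply hsubst_ext; auto. Qed.

Lemma subst_rename (G G' G'' : list ty) (A : ty) (t : @tm Sg G A) (r : ren G G')
    (s : sub G' G'') :
  subst s (rename r t) = subst (fun A v => s A (r A v)) t.
Proof. rewrite !subst_hsubst, hsubst_rename; reflexivity. Qed.

Lemma subst_subst (G G' G'' : list ty) (A : ty) (t : @tm Sg G A) (s : sub G G')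
    (s' : sub G' G'') :
  subst s' (subst s t) = subst (fun A v => subst s' (s A v)) t.
Proof.
  rewrite !subst_hsubst, hsubst_hsubst; apply hsubst_ext; [| reflexivity].
  intros; rewrite subst_hsubst; reflexivity.
Qed.

Lemma subst_Vars (G : list ty) (A : ty) (t : tm G A) (s : sub G G) :
  (forall A v, s A v = Var v) -> subst s t = t.
Proof. intros H; rewrite subst_hsubst; apply hsubst_id_ext; auto. Qed.

Lemma rename_subst (G G' : list ty) (A : ty) (t : @tm Sg G A) (r : ren G G') :
  rename r t = subst (fun A v => Var (r A v)) t.
Proof. rewrite rename_hsubst, subst_hsubst; reflexivity. Qed.

Lemma inst_subst (G G' : list ty) (A B : ty) (b : @tm Sg (A :: G) B) (s : sub G G')
    (u : tm G' A) :
  inst (subst (sub_up s) b) u = subst (scons u s) b.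
Proof.
  unfold inst; rewrite subst_subst; apply subst_ext.
  apply mem_case; [reflexivity |]; intros C w; simpl.
  unfold wk; rewrite subst_rename; apply subst_Vars; reflexivity.
Qed.

Lemma inst_rename_MZ (G : list ty) (A B : ty) (b : @tm Sg (A :: G) B) :
  inst (rename (ren_up (@ren_shift Sg G A)) b) (Var (MZ G A)) = b.
Proof.
  unfold inst; rewrite subst_rename; apply subst_Vars.
  apply mem_case; reflexivity.
Qed.

Lemma tms_map_map (G G' G'' : list ty) (f : forall A, @tm Sg G A -> @tm Sg G' A)
    (g : forall A, tm G' A -> @tm Sg G'' A) (As : list ity) (ts : tms G As) :
  tms_map g (tms_map f ts) = tms_map (fun A t => g A (f A t)) ts.
Proof. induction ts; simpl; congruence. Qed.

Lemma tms_map_ext (G G' : list ty) (f g : forall A, @tm Sg G A -> @tm Sg G' A)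
    (As : list ity) (ts : tms G As) :
  (forall A t, f A t = g A t) -> tms_map f ts = tms_map g ts.
Proof. intros H; induction ts; simpl; congruence. Qed.

Lemma tms_map_id (G : list ty) (f : forall A, @tm Sg G A -> @tm Sg G A)
    (As : list ity) (ts : tms G As) :
  (forall A t, f A t = t) -> tms_map f ts = ts.
Proof. intros H; induction ts; simpl; congruence. Qed.

Lemma hsubst_apps (G G' : list ty) (s : sub G G') (n : nsub G') (As : list ity)
    (A : ty) (t : tm G (arrs As A)) (ts : tms G As) :
  hsubst s n (apps t ts) = apps (hsubst s n t) (tms_map (fun A => @hsubst G G' A s n) ts).
Proof. induction ts; simpl; auto; rewrite IHts; reflexivity. Qed.

Lemma subst_apps (G G' : list ty) (s : sub G G') (As : list ity)
    (A : ty) (t : tm G (arrs As A)) (ts : tms G As) :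
  subst s (apps t ts) = apps (subst s t) (tms_map (fun A => @subst Sg G G' A s) ts).
Proof. induction ts; simpl; auto; rewrite IHts; reflexivity. Qed.

Lemma subst_wk0 (G G' : list ty) (s : sub G G') (A : ty) (t : @tm Sg [] A) :
  subst s (wk0 G t) = wk0 G' t.
Proof.
  unfold wk0; rewrite subst_rename, rename_subst; apply subst_ext.
  intros B v; inversion v.
Qed.

Lemma tms_map_eq_rect (G G' : list ty) (f : forall A, @tm Sg G A -> @tm Sg G' A)
    (As Bs : list ity) (e : As = Bs) (ts : tms G As) :
  tms_map f (eq_rect As (tms G) ts Bs e) = eq_rect As (tms G') (tms_map f ts) Bs e.
Proof. destruct e; reflexivity. Qed.

Lemma hsubst_kapp (G G' : list ty) (s : sub G G') (n : nsub G') (p : pred) (k : kst)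
    (e : pargs p = kargs k) (ts : tms G (pargs p)) :
  hsubst s n (kapp e ts) = kapp e (tms_map (fun A => @hsubst G G' A s n) ts).
Proof. unfold kapp; rewrite hsubst_apps, tms_map_eq_rect; reflexivity. Qed.

Lemma subst_kapp (G G' : list ty) (s : sub G G') (p : pred) (k : kst)
    (e : pargs p = kargs k) (ts : tms G (pargs p)) :
  subst s (kapp e ts) = kapp e (tms_map (fun A => @subst Sg G G' A s) ts).
Proof. unfold kapp; rewrite subst_apps, tms_map_eq_rect; reflexivity. Qed.

Lemma subst_lams (As : list ity) (A : ty) : forall (G G' : list ty) (s : sub G G')
    (M : @tm Sg (ext As G) A),
  subst s (lams M) = lams (subst (sub_ups As s) M).
Proof. induction As; intros; simpl; auto; rewrite IHAs; reflexivity. Qed.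

Lemma subst_Exs (As : list ity) : forall (G G' : list ty) (s : sub G G')
    (M : form (ext As G)),
  subst s (Exs M) = Exs (subst (sub_ups As s) M).
Proof. induction As; intros; simpl; auto; rewrite IHAs; reflexivity. Qed.

Lemma subst_Nablas (As : list ity) : forall (G G' : list ty) (s : sub G G')
    (M : form (ext As G)),
  subst s (Nablas M) = Nablas (subst (sub_ups As s) M).
Proof. induction As; intros; simpl; auto; rewrite IHAs; reflexivity. Qed.

Lemma subst_Ors (G G' : list ty) (s : sub G G') (Bs : list (form G)) :
  subst s (Ors Bs) = Ors (map (subst s) Bs).
Proof.
  induction Bs as [| B [| B' Bs] IH]; auto.
  change (Or (subst s B) (subst s (Ors (B' :: Bs))) =
          Or (subst s B) (Ors (map (subst s) (B' :: Bs)))).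
  rewrite IH; reflexivity.
Qed.

Lemma ren_ups_ext (As : list ity) : forall (G G' : list ty) (r : ren G G')
    (A : ty) (v : mem G A),
  ren_ups As r A (ren_ext As v) = @ren_ext Sg As G' A (r A v).
Proof. induction As; intros; simpl; auto; rewrite IHAs; reflexivity. Qed.

Lemma sub_ups_ren_ext (As : list ity) : forall (G G' : list ty) (s : sub G G')
    (A : ty) (v : mem G A),
  sub_ups As s (ren_ext As v) = rename (@ren_ext Sg As G') (s A v).
Proof.
  induction As as [| a As IH]; intros; simpl.
  - rewrite rename_subst, subst_Vars; reflexivity.
  - rewrite IH; simpl; unfold wk; rewrite rename_rename; reflexivity.
Qed.

Lemma sub_ups_ext (As : list ity) : forall (G G' : list ty) (s s' : sub G G'),
  (forall A v, s A v = s' A v) -> forall A v, sub_ups As s (A := A) v = sub_ups As s' v.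
Proof.
  induction As as [| a As IH]; intros G G' s s' H; simpl; auto.
  apply IH; apply mem_case; [reflexivity |]; intros; simpl; rewrite H; reflexivity.
Qed.

Lemma sub_ups_ren_ups (As : list ity) : forall (G G' G'' : list ty) (r : ren G G')
    (s : sub G' G'') (A : ty) (v : mem (ext As G) A),
  sub_ups As s (ren_ups As r A v) = sub_ups As (fun A v => s A (r A v)) v.
Proof.
  induction As as [| a As IH]; intros; simpl; auto.
  rewrite IH; apply sub_ups_ext; apply mem_case; reflexivity.
Qed.

Lemma sub_tms_ext (As : list ity) (G' : list ty) (us : tms G' As) :
  forall (G : list ty) (s s' : sub G G'), (forall A v, s A v = s' A v) ->
  forall A v, sub_tms us s (A := A) v = sub_tms us s' v.
Proof.
  induction us; intros G s s' H; simpl; auto.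
  apply IHus; apply mem_case; [reflexivity |]; intros; simpl; auto.
Qed.

Lemma sub_tms_ren_ext (As : list ity) (G' : list ty) (us : tms G' As) :
  forall (G : list ty) (s : sub G G') (A : ty) (v : mem G A),
  sub_tms us s (ren_ext As v) = s A v.
Proof. induction us; intros; simpl; auto; rewrite IHus; reflexivity. Qed.

(** Every substitution on an extended context is an instantiation of its telescope, so a given [th]
    can be realized by left rules for universal quantifiers. *)
Lemma sub_tms_vars (As : list ity) : forall (G G' : list ty) (th : sub (ext As G) G')
    (A : ty) (v : mem (ext As G) A),
  sub_tms (tms_map (fun A => @subst Sg _ _ A th) (vars As G))
    (fun A v => th A (ren_ext As v)) v = th A v.
Proof.
  induction As as [| a As IH]; intros; simpl; auto.
  etransitivity; [| apply IH]; apply sub_tms_ext; apply mem_case; reflexivity.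
Qed.

Lemma subst_sub_tms_vars (As : list ity) (G' : list ty) (us : tms G' As) :
  forall (G : list ty) (s : sub G G'),
  tms_map (fun A => @subst Sg _ _ A (sub_tms us s)) (vars As G) = us.
Proof.
  induction us; intros; simpl; auto.
  rewrite sub_tms_ren_ext, IHus; reflexivity.
Qed.

Lemma hsubst_vars (As : list ity) : forall (G G' : list ty) (r : ren G G')
    (s : sub (ext As G) (ext As G')) (n : nsub (ext As G')),
  (forall A v, s A v = Var (ren_ups As r A v)) ->
  tms_map (fun A => @hsubst _ _ A s n) (vars As G) = vars As G'.
Proof.
  induction As as [| a As IH]; intros G G' r s n H; simpl; auto.
  rewrite H, (IH _ _ (ren_up r)) by exact H; simpl.
  rewrite ren_ups_ext; reflexivity.
Qed.

Lemma rename_vars (As : list ity) (G G' : list ty) (r : ren G G') :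
  tms_map (fun A => @rename Sg _ _ A (ren_ups As r)) (vars As G) = vars As G'.
Proof.
  rewrite <- (@hsubst_vars As G G' r (fun A v => Var (ren_ups As r A v)) (@Noms _))
    by reflexivity.
  apply tms_map_ext; intros; apply rename_hsubst.
Qed.

Lemma conv_apps (G : list ty) (As : list ity) (A : ty) (ts us : tms G As) :
  tms_conv ts us -> forall t u : tm G (arrs As A),
  conv t u -> conv (apps t ts) (apps u us).
Proof. induction 1; intros; simpl; auto using conv_app. Qed.

Lemma tms_conv_refl (G : list ty) (As : list ity) (ts : @tms Sg G As) : tms_conv ts ts.
Proof. induction ts; constructor; auto using conv_refl. Qed.

Lemma conv_lams (As : list ity) (A : ty) : forall (G : list ty) (M M' : tm (ext As G) A),
  conv M M' -> conv (lams M) (lams M').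
Proof. induction As; intros; simpl; auto using conv_lam. Qed.

(** The pending substitution [s] absorbs one argument per beta step, through [inst_subst]. *)
Lemma lams_beta (As : list ity) (A : ty) (G' : list ty) (us : tms G' As) :
  forall (G : list ty) (s : sub G G') (M : tm (ext As G) A),
  conv (apps (subst s (lams M)) us) (subst (sub_tms us s) M).
Proof.
  induction us; intros G s M; simpl; [apply conv_refl |].
  eapply conv_trans; [| apply IHus].
  apply conv_apps; [apply tms_conv_refl |].
  rewrite <- inst_subst; apply conv_beta.
Qed.

Lemma lams_beta_vars (As : list ity) (A : ty) (G : list ty) (M : tm (ext As G) A) :
  conv (apps (rename (@ren_ext Sg As G) (lams M)) (vars As G)) M.
Proof.
  rewrite rename_subst; eapply conv_trans; [apply lams_beta |].
  apply conv_eq, subst_Vars; intros B v.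
  pose proof (sub_tms_vars (@Vars _) v) as E.
  rewrite tms_map_id in E; [exact E | intros; apply subst_Vars; reflexivity].
Qed.

Lemma lams_eta (As : list ity) (A : ty) : forall (G : list ty) (f : tm G (arrs As A)),
  conv (lams (apps (rename (@ren_ext Sg As G) f) (vars As G))) f.
Proof.
  induction As as [| a As IH]; intros G f; simpl.
  - rewrite rename_subst, subst_Vars by reflexivity; apply conv_refl.
  - eapply conv_trans; [| apply conv_eta]; apply conv_lam.
    eapply conv_trans; [| apply IH]; simpl.
    unfold wk; rewrite rename_rename; apply conv_refl.
Qed.

Lemma avoidable_apps (c : nom) (G : list ty) (As : list ity) (A : ty) (ts : tms G As) :
  tms_all (fun A t => avoidable c t) ts -> forall t : tm G (arrs As A),
  avoidable c t -> avoidable c (apps t ts).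
Proof. induction ts; simpl; intuition auto using avoidable_app. Qed.

Lemma avoidable_lams (c : nom) (As : list ity) (A : ty) :
  forall (G : list ty) (M : tm (ext As G) A), avoidable c M -> avoidable c (lams M).
Proof. induction As; intros; simpl; auto using avoidable_lam. Qed.

Lemma avoidable_Exs (c : nom) (As : list ity) :
  forall (G : list ty) (M : form (ext As G)), avoidable c M -> avoidable c (Exs M).
Proof.
  induction As; intros; simpl; auto.
  apply avoidable_app; auto using avoidable_log, avoidable_lam.
Qed.

Lemma avoidable_Alls (c : nom) (As : list ity) :
  forall (G : list ty) (M : form (ext As G)), avoidable c M -> avoidable c (Alls M).
Proof.
  induction As; intros; simpl; auto.
  apply avoidable_app; auto using avoidable_log, avoidable_lam.
Qed.

Lemma avoidable_Nablas (c : nom) (As : list ity) :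
  forall (G : list ty) (M : form (ext As G)), avoidable c M -> avoidable c (Nablas M).
Proof.
  induction As; intros; simpl; auto.
  apply avoidable_app; auto using avoidable_log, avoidable_lam.
Qed.

Lemma tms_all_map (G G' : list ty) (P : forall A, @tm Sg G A -> Prop)
    (Q : forall A, @tm Sg G' A -> Prop) (f : forall A, @tm Sg G A -> @tm Sg G' A)
    (As : list ity) (ts : tms G As) :
  (forall A t, P A t -> Q A (f A t)) -> tms_all P ts -> tms_all Q (tms_map f ts).
Proof. intros H; induction ts; simpl; intuition. Qed.

Lemma avoidable_vars (c : nom) (As : list ity) : forall G : list ty,
  tms_all (fun A t => @avoidable c _ A t) (vars As G).
Proof. induction As; simpl; auto using avoidable_var. Qed.

Lemma avoidable_kapp (c : nom) (G : list ty) (p : pred) (k : kst)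
    (e : pargs p = kargs k) (ts : tms G (pargs p)) :
  tms_all (fun A t => avoidable c t) ts -> avoidable c (kapp e ts).
Proof.
  intros H; apply avoidable_apps; [| apply avoidable_kst].
  destruct e; exact H.
Qed.

Lemma avoidable_sub_ups (c : nom) (As : list ity) : forall (G G' : list ty)
    (s : sub G G'), (forall A v, avoidable c (s A v)) ->
  forall A v, avoidable c (sub_ups As s (A := A) v).
Proof.
  induction As as [| a As IH]; intros G G' s H; simpl; auto.
  apply IH; apply mem_case; [apply avoidable_var |]; intros; apply avoidable_rename, H.
Qed.

Lemma avoidable_sub_tms (c : nom) (As : list ity) (G' : list ty) (us : tms G' As) :
  tms_all (fun A t => avoidable c t) us -> forall (G : list ty) (s : sub G G'),
  (forall A v, avoidable c (s A v)) -> forall A v, avoidable c (sub_tms us s (A := A) v).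
Proof.
  induction us; simpl; intros [Hu Hus] G s Hs || intros _ G s Hs; auto.
  apply IHus; auto; apply mem_case; auto.
Qed.

(** * Derived rules for telescopes *)

Lemma raise_nil (G : list ty) (a : ity) (B : form (inj a :: G)) : raise [] B = B.
Proof. unfold raise; apply subst_Vars; apply mem_case; reflexivity. Qed.

Lemma lists_supp_nil (G : list ty) (A : ty) (t : tm G A) :
  (forall c, avoidable c t) -> lists_supp [] t.
Proof.
  intros H; split; [constructor |]; intros c; split; [intros [] |].
  intros Hc; apply avoidable_in_supp in Hc; auto.
Qed.

Lemma der_ExsL (D : gdef Sg) (As : list ity) : forall (G : list ty)
    (M : form (ext As G)) (C : form G),
  (forall c, avoidable c M) -> der D [M] (rename (@ren_ext Sg As G) C) ->
  der D [Exs M] C.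
Proof.
  induction As as [| a As IH]; intros G M C HM H; simpl in *.
  - rewrite rename_subst, subst_Vars in H by reflexivity; exact H.
  - apply d_exL with (cs := []); [apply lists_supp_nil; auto using avoidable_Exs |].
    rewrite raise_nil; apply IH; auto.
    unfold wk; rewrite rename_rename; exact H.
Qed.

Lemma der_AllsR (D : gdef Sg) (As : list ity) : forall (G : list ty)
    (M : form (ext As G)),
  (forall c, avoidable c M) -> der D [] M -> der D [] (Alls M).
Proof.
  induction As as [| a As IH]; intros G M HM H; simpl in *; auto.
  apply d_allR with (cs := []); [apply lists_supp_nil; auto using avoidable_Alls |].
  rewrite raise_nil; apply IH; auto.
Qed.

Lemma der_AllsL (D : gdef Sg) (As : list ity) (G' : list ty) (us : tms G' As)
    (Gm : list (form G')) (C : form G') :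
  forall (G : list ty) (s : sub G G') (M : form (ext As G)),
  der D (subst (sub_tms us s) M :: Gm) C -> der D (subst s (Alls M) :: Gm) C.
Proof.
  induction us; intros G s M H; simpl in *; auto.
  apply d_allL with t; rewrite inst_subst; auto.
Qed.

Lemma der_OrsL (D : gdef Sg) (G : list ty) (Bs : list (form G)) (C : form G) :
  (forall B, In B Bs -> der D [B] C) -> der D [Ors Bs] C.
Proof.
  induction Bs as [| B [| B' Bs] IH]; intros H.
  - apply d_botL.
  - apply H; simpl; auto.
  - apply d_orL; [apply H; simpl; auto |].
    apply IH; intros B0 HB; apply H; right; exact HB.
Qed.

Lemma der_refl (D : gdef Sg) (G : list ty) (Gm : list (form G)) (B : form G) :
  der D (B :: Gm) B.
Proof.
  apply d_id; exists perm_id; rewrite permute_hsubst, hsubst_id_ext;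
    auto using conv_refl; intros [a n]; reflexivity.
Qed.

(* Closing the sequent under universal quantifiers makes weakening sufficient:
   closure of derivations under general substitutions is not needed. *)
Lemma der_subst_closed (D : gdef Sg) (As : list ity) (B C : form (ext As []))
    (G : list ty) (th : sub (ext As []) G) :
  eigen G -> (forall c, avoidable c B) -> (forall c, avoidable c C) ->
  der D [B] C -> der D [subst th B] (subst th C).
Proof.
  intros HE HB HC H.
  assert (HF : der D [] (Alls (Imp B C))).
  { apply der_AllsR; [| apply d_impR, H].
    intros c; repeat apply avoidable_app; auto using avoidable_log. }
  apply der_rename with (r := @ren_nil Sg G) in HF; [| apply retractable_ren_nil; auto].
  apply (@d_cut Sg D G [] [subst th B] (rename (@ren_nil Sg G) (Alls (Imp B C)))); auto.
  rewrite rename_subst.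
  (* The instances are the values of [th]; by [sub_tms_vars] together they form [th] itself. *)
  apply der_AllsL with (us := tms_map (fun A => @subst Sg _ _ A th) (vars As [])).
  rewrite (@subst_ext _ _ _ _ _ th); simpl.
  - apply d_impL; apply der_refl.
  - intros A v; rewrite <- (sub_tms_vars th v); apply sub_tms_ext.
    intros A0 v0; inversion v0.
Qed.

(** * From nominal abstraction to nabla-quantification *)

Fixpoint nablas_of (As : list ity) : forall G : list ty, tm G (arrs As TO) -> form G :=
  match As return forall G, tm G (arrs As TO) -> form G with
  | [] => fun G f => f
  | a :: As' => fun G f =>
      Nabla (a := a) (nablas_of (App (wk (inj a) f) (Var (MZ G (inj a)))))
  end.

(** Since [nablas_of] takes the abstraction itself, a conversion between an abstraction over
    variables and one over nominal constants passes to the quantified formulas. *)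
Lemma conv_nablas_of (As : list ity) : forall (G : list ty) (f g : tm G (arrs As TO)),
  conv f g -> conv (nablas_of f) (nablas_of g).
Proof.
  induction As as [| a As IH]; intros G f g H; simpl; auto.
  apply conv_app; [apply conv_refl |]; apply conv_lam, IH, conv_app;
    [apply conv_rename, H | apply conv_refl].
Qed.

Lemma Nablas_lams (As : list ity) : forall (G : list ty) (M : form (ext As G)),
  conv (Nablas M) (nablas_of (lams M)).
Proof.
  induction As as [| a As IH]; intros G M; simpl; [apply conv_refl |].
  apply conv_app; [apply conv_refl |]; apply conv_lam.
  eapply conv_trans; [apply IH |]; apply conv_nablas_of, conv_sym.
  eapply conv_trans; [apply conv_beta |].
  apply conv_eq, inst_rename_MZ.
Qed.

Lemma subst_nablas_of (As : list ity) : forall (G G' : list ty) (s : sub G G')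
    (f : tm G (arrs As TO)),
  subst s (nablas_of f) = nablas_of (subst s f).
Proof.
  induction As as [| a As IH]; intros G G' s f; simpl; auto.
  rewrite IH; simpl; unfold Nabla; do 5 f_equal.
  unfold wk; rewrite subst_rename, rename_subst, subst_subst; apply subst_ext.
  intros; apply rename_subst.
Qed.

Lemma avoidable_nablas_of (c : nom) (As : list ity) : forall (G : list ty)
    (f : tm G (arrs As TO)),
  avoidable c f -> avoidable c (nablas_of f).
Proof.
  induction As as [| a As IH]; intros G f H; simpl; auto.
  apply avoidable_app; [apply avoidable_log |]; apply avoidable_lam, IH.
  apply avoidable_app; [apply avoidable_rename, H | apply avoidable_var].
Qed.

Lemma lam_nom_avoidable (c : nom) (G : list ty) (A : ty) (t : tm G A) :
  avoidable c (lam_nom c t).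
Proof.
  apply avoidable_lam; rewrite repl_hsubst; apply avoidable_hsubst_occ.
  - intros; apply avoidable_var.
  - intros d _; unfold repl_nsub; destruct (nom_dec c d) as [e | e].
    + apply avoidable_var.
    + exists (Nom d); split; [apply conv_refl | simpl; congruence].
Qed.

Lemma lam_nom_beta (c : nom) (G : list ty) (A : ty) (t : tm G A) :
  conv (App (lam_nom c t) (Nom c)) t.
Proof.
  eapply conv_trans; [apply conv_beta |]; apply conv_eq.
  to_hsubst; apply hsubst_id_ext; [reflexivity |].
  intros d; simpl; unfold repl_nsub.
  destruct (nom_dec c d) as [e |]; [destruct e |]; reflexivity.
Qed.

(** Each nabla is instantiated with the very constant that was abstracted: it is fresh for the
    abstraction, and beta restores the body. *)
Lemma der_nablas_lam_noms (D : gdef Sg) (G : list ty) (Gm : list (form G))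
    (M C : form G) (cs : list nom) :
  der D (M :: Gm) C -> der D (nablas_of (lam_noms cs M) :: Gm) C.
Proof.
  intros H; induction cs as [| c cs IH]; simpl; auto.
  apply (@d_nablaL Sg D G Gm c).
  - apply avoidable_in_supp, avoidable_nablas_of, avoidable_app.
    + apply avoidable_rename, lam_nom_avoidable.
    + apply avoidable_var.
  - eapply der_conv; [| apply conv_refl | exact IH].
    unfold inst; rewrite subst_nablas_of; apply conv_nablas_of, conv_sym.
    cbn [subst]; unfold wk; rewrite subst_rename, subst_Vars by reflexivity.
    apply lam_nom_beta.
Qed.

(** The substitution is the same for all terms of all types, so it distributes over an application
    and acts on head and arguments separately. *)
Lemma lam_noms_hsubst (cs : list nom) (G : list ty) :
  exists (s : sub G (ext (map fst cs) G)) (n : nsub (ext (map fst cs) G)),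
  forall (A : ty) (t : tm G A),
    conv (apps (rename (@ren_ext Sg (map fst cs) G) (lam_noms cs t))
            (vars (map fst cs) G))
         (hsubst s n t).
Proof.
  induction cs as [| c cs [s [n IH]]]; simpl.
  - exists (@Vars G), (@Noms G); intros A t.
    rewrite rename_subst, subst_Vars, hsubst_id by reflexivity; apply conv_refl.
  - set (As := map fst cs) in *.
    (* Raise the context of the induction hypothesis, turning c into the new variable. *)
    set (s1 := fun A v => @Var Sg (ext As (inj (fst c) :: G)) A
                 (ren_ups As (@ren_shift Sg G (inj (fst c))) A v)).
    set (n1 := repl_nsub (ren_ext As (MZ G (inj (fst c))))).
    exists (fun A v => hsubst s1 n1 (s A v)), (fun d => hsubst s1 n1 (n d)); intros A t.
    rewrite <- hsubst_hsubst.
    eapply conv_trans; [| apply conv_hsubst, IH].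
    rewrite hsubst_apps.
    rewrite (@hsubst_vars As _ _ (@ren_shift Sg G (inj (fst c)))) by reflexivity.
    apply conv_apps; [apply tms_conv_refl |].
    eapply conv_trans; [apply conv_beta |]; apply conv_eq.
    to_hsubst; apply hsubst_ext.
    + intros B v; simpl; unfold s1; rewrite ren_ups_ext; reflexivity.
    + intros d; simpl; unfold n1, repl_nsub.
      destruct (nom_dec c d) as [e |]; [destruct e |]; reflexivity.
Qed.

Lemma kapp_inj (G : list ty) (p : pred) (k : kst) (e : pargs p = kargs k)
    (us vs : tms G (pargs p)) :
  conv (kapp e us) (kapp e vs) -> tms_conv us vs.
Proof. intros H; apply kst_apps_inj in H; destruct e; exact H. Qed.

(** Injectivity makes [us] the image of [vs] under the substitution of variables for [cs]. As this
    fixes [T], abstracting [cs] from [T vs] gives the same function as abstracting [zs] from [T us],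
    and the nablas can be removed with [cs]. *)
Lemma der_Nablas_of_nabs (D : gdef Sg) (p : pred) (k : kst) (e : pargs p = kargs k)
    (T : tm [] (pty p)) (G : list ty) (zs : list ity)
    (us : tms (ext zs G) (pargs p)) (vs : tms G (pargs p)) (Gm : list (form G))
    (C : form G) :
  no_nom T -> nabs_holds (As := zs) (lams (kapp e us)) (kapp e vs) ->
  der D (apps (wk0 G T) vs :: Gm) C -> der D (Nablas (apps (wk0 _ T) us) :: Gm) C.
Proof.
  intros HT [cs [<- [_ Hc]]] H; simpl in Hc.
  destruct (lam_noms_hsubst cs G) as [s [n Hn]].
  (* Both sides of the abstraction equation are applied to the bound variables before the head
     constant is cancelled. *)
  assert (Hus : tms_conv us (tms_map (fun A => @hsubst _ _ A s n) vs)).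
  { apply kapp_inj with (e := e); rewrite <- hsubst_kapp.
    eapply conv_trans; [apply conv_sym, lams_beta_vars |].
    eapply conv_trans; [| apply Hn].
    apply conv_apps; [apply tms_conv_refl | apply conv_rename, Hc]. }
  eapply der_conv; [| apply conv_refl | apply der_nablas_lam_noms with (cs := cs), H].
  apply conv_sym; eapply conv_trans; [apply Nablas_lams |]; apply conv_nablas_of.
  eapply conv_trans; [| apply lams_eta]; apply conv_lams.
  eapply conv_trans; [| apply conv_sym, Hn].
  rewrite hsubst_apps; apply conv_apps; [exact Hus |].
  apply conv_sym; eapply conv_trans; [apply no_nom_hsubst |].
  - apply no_nom_avoidable; intros; apply avoidable_wk0, HT.
  - rewrite subst_wk0; apply conv_refl.
Qed.

Lemma conv_lam_noms (cs : list nom) (G : list ty) (A : ty) (t u : tm G A) :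
  conv t u -> conv (lam_noms cs t) (lam_noms cs u).
Proof.
  intros H; induction cs as [| c cs IH]; simpl; auto.
  apply conv_lam; rewrite !repl_hsubst; apply conv_hsubst, conv_rename, IH.
Qed.

Lemma nabs_holds_conv (G : list ty) (As : list ity) (A : ty)
    (s s' : tm G (arrs As A)) (t t' : tm G A) :
  conv s s' -> conv t t' -> nabs_holds s t -> nabs_holds s' t'.
Proof.
  intros Hs Ht [cs [e [Hd Hc]]]; exists cs, e; split; auto; destruct e; simpl in *.
  eapply conv_trans; [apply conv_sym, Hs |]; eapply conv_trans; [apply Hc |].
  apply conv_lam_noms, Ht.
Qed.

Lemma ncas_no_nom (G G' : list ty) (th : sub G G') (A : ty) (t : tm G A) :
  no_nom t -> ncas th t (subst th t).
Proof.
  intros H; exists perm_id; split.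
  - intros c Hc; destruct (H c Hc).
  - rewrite permute_hsubst, hsubst_id_ext; auto; intros [a n]; reflexivity.
Qed.

(* Without nominal constants the permutations in solutions and in
   capture-avoiding substitution are immaterial. *)
Lemma der_nabsL_no_nom (D : gdef Sg) (G : list ty) (As : list ity) (A : ty)
    (s : tm G (arrs As A)) (t : tm G A) (B C : form G) :
  no_nom s -> no_nom t -> no_nom B -> no_nom C ->
  (forall G' (th : sub G G'), eigen G' -> nabs_holds (subst th s) (subst th t) ->
     der D [subst th B] (subst th C)) ->
  der D [And (Nabs s t) B] C.
Proof.
  intros Hs Ht HB HC H; apply d_cL, d_andL1.
  apply der_perm with [And (Nabs s t) B; Nabs s t]; [apply perm_swap |].
  apply d_andL2; apply der_perm with [Nabs s t; B]; [apply perm_swap |].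
  apply d_nabsL with (fun G' th => [subst th B]) (fun G' th => subst th C).
  - intros; constructor; auto using ncas_no_nom.
  - intros; apply ncas_no_nom, HC.
  - intros G' th HE [pi [_ Hpi]]; apply H; auto.
    eapply nabs_holds_conv; [| | exact Hpi]; apply conv_subst, no_nom_permute; auto.
Qed.

(** * The induction rule for pattern-based definitions *)

(** One case of the induction: the predicate variable of the disjunct becomes [T], and the clause
    arguments become the eigenvariables of the induction premise. *)
Lemma tr_disj_step (D : gdef Sg) (lvl : pred -> nat) (p : pred) (k : kst)
    (e : pargs p = kargs k) (c : pclause p) (T : tm [] (pty p))
    (s0 : sub [] (ext (pargs p) [])) :
  wf_pclause lvl c -> no_nom T ->
  der D [apps (App (wk0 (ext (pc_xs c) []) (pc_body c)) (wk0 _ T)) (vars (pc_xs c) [])]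
        (Nablas (As := pc_zs c) (apps (wk0 _ T) (pc_ts c))) ->
  der D [subst (sub_tms (vars (pargs p) []) (scons (wk0 _ T) s0)) (tr_disj e c)]
        (apps (wk0 _ T) (vars (pargs p) [])).
Proof.
  intros [Hts _ Hbody _] HT Hprem.
  destruct c as [xs zs ts body]; simpl in *.
  assert (Hts' : forall d, tms_all (fun A t => avoidable d t) ts).
  { intros d; clear - Hts; induction ts; simpl in *; auto.
    destruct Hts; split; auto; apply avoidable_in_supp; auto. }
  set (sg := sub_tms _ _).
  assert (Hsg : forall d A v, avoidable d (sub_ups xs sg (A := A) v)).
  { intros d; apply avoidable_sub_ups, avoidable_sub_tms; [apply avoidable_vars |].
    apply mem_case; [apply avoidable_wk0, HT |]; intros A w; inversion w. }
  unfold tr_disj; simpl; rewrite subst_Exs; simpl.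
  match goal with |- context [subst (sub_ups xs sg) (lams ?M)] => set (M0 := M) end.
  match goal with |- context [subst (sub_ups xs sg) (kapp e ?M)] => set (ys := M) end.
  match goal with |- context [subst (sub_ups xs sg) (apps ?a ?b)] =>
    set (B0 := apps a b) end.
  assert (Hs : no_nom (subst (sub_ups xs sg) (lams M0))).
  { apply no_nom_avoidable; intros d; apply avoidable_subst; auto.
    apply avoidable_lams, avoidable_kapp.
    apply tms_all_map with (fun A t => avoidable d t); auto using avoidable_rename. }
  assert (Ht : no_nom (subst (sub_ups xs sg) (kapp e ys))).
  { apply no_nom_avoidable; intros d; apply avoidable_subst; auto.
    apply avoidable_kapp.
    apply tms_all_map with (fun A t => avoidable d t);
      auto using avoidable_rename, avoidable_vars. }
  assert (HB : no_nom (subst (sub_ups xs sg) B0)).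
  { apply no_nom_avoidable; intros d; apply avoidable_subst; auto.
    apply avoidable_apps; [apply avoidable_vars |].
    apply avoidable_app; [apply avoidable_wk0, Hbody | apply avoidable_var]. }
  apply der_ExsL.
  { intros d; repeat apply avoidable_app; auto using avoidable_log;
      apply avoidable_in_supp; auto. }
  apply der_nabsL_no_nom; auto.
  { apply no_nom_avoidable; intros d; apply avoidable_rename, avoidable_apps.
    - apply avoidable_vars.
    - apply avoidable_wk0, HT. }
  intros G th HE Hnabs.
  (* [tau] is everything applied to the disjunct below its existentials; [th'] restricts it to the
     clause variables [xs], the only ones in the premise of the clause. *)
  set (tau := fun A (v : mem (ext xs (ext (pargs p) [pty p])) A) =>
    subst th (sub_ups xs sg v)).
  set (th' := fun A (v : mem (ext xs []) A) => tau A (ren_ups xs (@ren_nil Sg _) A v)).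
  assert (Htau : forall A v, tau A (ren_ext xs v) =
    subst (fun A v => th A (ren_ext xs v)) (sg A v)).
  { intros A v; unfold tau; rewrite sub_ups_ren_ext, subst_rename; reflexivity. }
  rewrite subst_rename, subst_apps, subst_wk0.
  rewrite subst_subst in Hnabs |- *; fold tau in Hnabs |- *.
  rewrite subst_subst in Hnabs; fold tau in Hnabs.
  assert (HM : subst tau (lams M0) =
    lams (kapp e (tms_map (fun A => @subst Sg _ _ A (sub_ups zs th')) ts))).
  { unfold M0; rewrite subst_lams, subst_kapp, tms_map_map; do 2 f_equal.
    apply tms_map_ext; intros A t; rewrite subst_rename; apply subst_ext.
    intros; apply sub_ups_ren_ups. }
  set (vs := tms_map _ (vars (pargs p) [])).
  assert (Hys : tms_map (fun A => @subst Sg _ _ A tau) ys = vs).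
  { unfold ys; rewrite tms_map_map; unfold vs.
    rewrite <- (subst_sub_tms_vars (vars (pargs p) []) (scons (wk0 _ T) s0)).
    rewrite tms_map_map; apply tms_map_ext; intros A t.
    rewrite subst_rename, subst_subst; apply subst_ext; apply Htau. }
  assert (HB0 : subst tau B0 =
    subst th' (apps (App (wk0 _ body) (wk0 _ T)) (vars xs []))).
  { unfold B0; rewrite !subst_apps; cbn [subst]; rewrite !subst_wk0, Htau.
    unfold sg; rewrite sub_tms_ren_ext; cbn [scons]; rewrite subst_wk0; f_equal.
    rewrite <- (rename_vars xs (@ren_nil Sg (ext (pargs p) [pty p]))), tms_map_map.
    apply tms_map_ext; intros; apply subst_rename. }
  rewrite HM, subst_kapp, Hys in Hnabs; rewrite HB0.
  (* The cut formula is the conclusion of the clause premise under [th']: an instance of that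
     premise proves it, and the nominal abstraction consumes it. *)
  apply (@d_cut Sg D G [_] [] (subst th' (Nablas (apps (wk0 _ T) ts)))).
  - apply der_subst_closed; auto.
    + intros d; apply avoidable_apps; [apply avoidable_vars |].
      apply avoidable_app; apply avoidable_wk0; auto.
    + intros d; apply avoidable_Nablas, avoidable_apps; auto using avoidable_wk0.
  - rewrite subst_Nablas, subst_apps, subst_wk0.
    apply der_Nablas_of_nabs with (e := e) (vs := vs); auto using der_refl.
Qed.

End Theory.

Theorem theorem5 (Sg : signature) (lvl : pred Sg -> nat)
  (p : pred Sg) (cs : list (pclause p)) (D0 : gdef Sg)
  (p' : kst Sg) (e : pargs p = kargs p')
  (wf_cs : forall c, In c cs -> wf_pclause lvl c)
  (wf_D0 : wf_gdef lvl D0)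
  (p_undef : ~ In p (map (@cl_pred Sg) D0))
  (p'_new : new_kst cs D0 p') :
  let D := @Clause Sg p Mu (translate e cs) :: D0 in
  forall (S : tm [] (pty p)) (Sigma : list (ty (sort Sg)))
    (Gamma : list (tm Sigma TO)) (ss : tms Sigma (pargs p)) (C : tm Sigma TO),
    eigen Sigma ->
    no_nom S ->
    (forall c, In c cs ->
       der D [apps (App (wk0 (ext (pc_xs c) []) (pc_body c)) (wk0 _ S))
                   (vars (pc_xs c) [])]
             (Nablas (As := pc_zs c) (apps (wk0 _ S) (pc_ts c)))) ->
    der D (apps (wk0 Sigma S) ss :: Gamma) C ->
    der D (apps (Pred p) ss :: Gamma) C.
Proof.
  intros D S Sigma Gamma ss C _ HS Hprem Hmajor.
  apply d_IL with (translate e cs) S; auto; [left; reflexivity |].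
  set (s0 := fun A v => Var (@ren_nil Sg (ext (pargs p) []) A v)).
  (* The substitution left after beta-reducing the translated body applied to [S] and the
     eigenvariables of the induction premise. *)
  set (sg := sub_tms (vars (pargs p) []) (scons (wk0 _ S) s0)).
  apply der_conv with (subst sg (Ors (map (tr_disj e) cs)))
    (apps (wk0 _ S) (vars (pargs p) [])).
  - apply conv_sym; unfold wk0 at 1; rewrite rename_subst; fold s0.
    eapply conv_trans; [| apply lams_beta].
    apply conv_apps; [apply tms_conv_refl |].
    rewrite <- inst_subst; apply conv_beta.
  - apply conv_refl.
  - rewrite subst_Ors, map_map; apply der_OrsL; intros B HB.
    apply in_map_iff in HB; destruct HB as [c [<- Hc]].
    eapply tr_disj_step; eauto.
Qed.
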